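(* Let $d \in (0,1)$ with $d > \frac13$. For each $m \ge 1$ let $\Gamma$ be a random group in the triangular model with $m$ generators at density $d$. Then $\Gamma$ has property (T) with overwhelming probability, i.e. $$\lim_{m\to\infty} \mathbb{P}\big(\Gamma \text{ has property (T)}\big) = 1 .$$
   Context: Property (T) is Kazhdan's property (T) for discrete, finitely generated groups. Let $S=\{s_1,\dots,s_m\}$ be a set of $m$ generators. A word $r=x_1x_2\cdots x_k$ with letters $x_i\in S\cup S^{-1}$ is cyclically reduced if $x_i\neq x_{i+1}^{-1}$ for $1\le i\le k$, where $x_{k+1}$ is identified with $x_1$. A random group in the triangular model with $m$ generators at density $d\in(0,1)$ is $\Gamma=\langle S\mid R\rangle$, where $R$ consists of $\lfloor (2m-1)^{3d}\rfloor$ relators chosen uniformly and independently (repetitions allowed) from the set of all cyclically reduced words of length $3$ over $S\cup S^{-1}$. *)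

(* Defs.v *)
From HB Require Import structures.
From mathcomp Require Import all_boot all_order all_algebra.
From mathcomp Require Import all_classical all_reals all_analysis.
From mathcomp Require Import complex.

Set Implicit Arguments.
Unset Strict Implicit.
Unset Printing Implicit Defensive.

Import Order.TTheory GRing.Theory Num.Theory.
Import numFieldNormedType.Exports.

Local Open Scope quotient_scope.

(* A letter (s, b) over the alphabet S stands for s if b = false and for
   s^-1 if b = true. *)
Definition letter (S : Type) : Type := (S * bool)%type.

Definition word (S : Type) : Type := seq (letter S).

HB.instance Definition _ (S : eqType) := Equality.on (letter S).
HB.instance Definition _ (S : choiceType) := Choice.on (letter S).
HB.instance Definition _ (S : finType) := Finite.on (letter S).
HB.instance Definition _ (S : choiceType) := Choice.on (word S).

Definition letterV (S : Type) (x : letter S) : letter S := (x.1, ~~ x.2).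

Definition wordV (S : Type) (w : word S) : word S := rev (map (@letterV S) w).

Definition cyclically_reduced (S : eqType) (w : word S) : bool :=
  cycle (fun x y => x != letterV y) w.

Section Presentation.
Variables (S : choiceType) (Rel : seq (word S)).

(* Equality of words in the free group on S modulo the normal closure of Rel. *)
Inductive pres_eq : word S -> word S -> Prop :=
| pres_refl u : pres_eq u u
| pres_sym u v : pres_eq u v -> pres_eq v u
| pres_trans u v w : pres_eq u v -> pres_eq v w -> pres_eq u w
| pres_cancel u v x : pres_eq (u ++ [:: x; letterV x] ++ v) (u ++ v)
| pres_relator u v r : r \in Rel -> pres_eq (u ++ r ++ v) (u ++ v).

Definition pres_eqb : rel (word S) := fun u v => `[< pres_eq u v >].

Lemma pres_eqb_refl : reflexive pres_eqb.
Proof. by move=> u; apply/asboolP; exact: pres_refl. Qed.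

Lemma pres_eqb_sym : symmetric pres_eqb.
Proof.
by move=> u v; apply/asboolP/asboolP; exact: pres_sym.
Qed.

Lemma pres_eqb_trans : transitive pres_eqb.
Proof.
move=> v u w /asboolP uv /asboolP vw; apply/asboolP.
exact: pres_trans vw.
Qed.

Canonical pres_equiv :=
  EquivRel pres_eqb pres_eqb_refl pres_eqb_sym pres_eqb_trans.

Definition presented : Type := {eq_quot pres_equiv}.

HB.instance Definition _ := EqQuotient.on presented.
HB.instance Definition _ := Choice.on presented.

Lemma presentedP (u v : word S) :
  reflect (pres_eq u v) (\pi_presented u == \pi_presented v).
Proof. by rewrite piE; exact: asboolP. Qed.

Lemma pres_eq_repr (u : word S) : pres_eq (repr (\pi_presented u)) u.
Proof. by apply/presentedP; rewrite reprK. Qed.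

Lemma pres_eq_cat u u' v v' :
  pres_eq u u' -> pres_eq v v' -> pres_eq (u ++ v) (u' ++ v').
Proof.
have catr w1 w2 w : pres_eq w1 w2 -> pres_eq (w1 ++ w) (w2 ++ w).
  elim=> {w1 w2} [w1|w1 w2 _ |w1 w2 w3 _ + _|w1 w2 x|w1 w2 r rR].
  - exact: pres_refl.
  - exact: pres_sym.
  - exact: pres_trans.
  - by rewrite -!catA; exact: pres_cancel.
  - by rewrite -!catA; exact: pres_relator.
have catl w1 w2 w : pres_eq w1 w2 -> pres_eq (w ++ w1) (w ++ w2).
  elim=> {w1 w2} [w1|w1 w2 _ |w1 w2 w3 _ + _|w1 w2 x|w1 w2 r rR].
  - exact: pres_refl.
  - exact: pres_sym.
  - exact: pres_trans.
  - by rewrite ![in X in pres_eq X]catA -!catA catA [w ++ w1 ++ w2]catA; exact: pres_cancel.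
  - by rewrite !(catA w w1); exact: pres_relator.
by move=> uu' vv'; exact: pres_trans (catr _ _ _ uu') (catl _ _ _ vv').
Qed.

Lemma letterVK : involutive (@letterV S).
Proof. by case=> s b; rewrite /letterV /= negbK. Qed.

Lemma wordVK : involutive (@wordV S).
Proof.
by move=> w; rewrite /wordV map_rev revK -map_comp map_id_in// => x _ /=; exact: letterVK.
Qed.

Lemma wordV_cat (u v : word S) : wordV (u ++ v) = wordV v ++ wordV u.
Proof. by rewrite /wordV map_cat rev_cat. Qed.

Lemma pres_mulwV (u : word S) : pres_eq (u ++ wordV u) [::].
Proof.
elim/last_ind: u => [|u x ih]; first exact: pres_refl.
rewrite /wordV map_rcons rev_rcons -cats1 -catA.
exact: pres_trans (pres_cancel _ _ _) ih.
Qed.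

Lemma pres_mulVw (u : word S) : pres_eq (wordV u ++ u) [::].
Proof. by rewrite -[X in _ ++ X]wordVK; exact: pres_mulwV. Qed.

Lemma pres_eqV u v : pres_eq u v -> pres_eq (wordV u) (wordV v).
Proof.
move=> uv; have uVv : pres_eq (wordV u ++ v) [::].
  apply: pres_trans (pres_mulVw u); apply: pres_eq_cat (pres_sym uv).
  exact: pres_refl.
apply: (@pres_trans _ (wordV u ++ (v ++ wordV v))).
  rewrite -[X in pres_eq X]cats0; apply: pres_eq_cat; first exact: pres_refl.
  exact/pres_sym/pres_mulwV.
rewrite catA -[X in pres_eq _ X]cat0s; apply: pres_eq_cat => //.
exact: pres_refl.
Qed.

Definition pres_one : presented := \pi_presented [::].
Definition pres_mul (x y : presented) : presented :=
  \pi_presented (repr x ++ repr y).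
Definition pres_inv (x : presented) : presented :=
  \pi_presented (wordV (repr x)).

Lemma pres_mul_pi (u v : word S) :
  pres_mul (\pi_presented u) (\pi_presented v) = \pi_presented (u ++ v).
Proof. by apply/eqP/presentedP; apply: pres_eq_cat; exact: pres_eq_repr. Qed.

Lemma pres_inv_pi (u : word S) :
  pres_inv (\pi_presented u) = \pi_presented (wordV u).
Proof. by apply/eqP/presentedP; apply: pres_eqV; exact: pres_eq_repr. Qed.

Lemma pres_mulA : associative pres_mul.
Proof.
move=> x y z; rewrite -[x]reprK -[y]reprK -[z]reprK.
by rewrite (pres_mul_pi (repr y)) (pres_mul_pi (repr x) (repr y)) !pres_mul_pi catA.
Qed.

Lemma pres_mul1 : left_id pres_one pres_mul.
Proof. by move=> x; rewrite -[x]reprK pres_mul_pi. Qed.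

Lemma pres_mulr1 : right_id pres_one pres_mul.
Proof. by move=> x; rewrite -[x]reprK pres_mul_pi cats0. Qed.

Lemma pres_mulV : left_inverse pres_one pres_inv pres_mul.
Proof.
move=> x; rewrite -[x]reprK pres_inv_pi pres_mul_pi.
by apply/eqP/presentedP; exact: pres_mulVw.
Qed.

Lemma pres_mulrV : right_inverse pres_one pres_inv pres_mul.
Proof.
move=> x; rewrite -[x]reprK pres_inv_pi pres_mul_pi.
by apply/eqP/presentedP; exact: pres_mulwV.
Qed.

HB.instance Definition _ := isGroup.Build presented
  pres_mulA pres_mul1 pres_mulr1 pres_mulV pres_mulrV.

End Presentation.

Section PropertyT.
Local Open Scope ring_scope.
Local Open Scope complex_scope.
Variable R : realType.

(* A complex Hilbert space is a complete normed space H over R[i] together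
   with an inner product (linear in the first argument, conjugate-linear in
   the second) that induces the norm. *)
Definition induces_norm (H : completeNormedModType R[i])
    (dot : {dot H for Num.conj}) : Prop :=
  forall v : H, `|v| ^+ 2 = dot v v.

Definition unitary_rep (G : groupType) (H : completeNormedModType R[i])
    (dot : {dot H for Num.conj}) (rho : G -> {linear H -> H}) : Prop :=
  [/\ forall v, rho 1%g v = v,
      forall g h v, rho (g * h)%g v = rho g (rho h v)
    & forall g u v, dot (rho g u) (rho g v) = dot u v].

Definition has_almost_invariant (G : groupType) (H : completeNormedModType R[i])
    (rho : G -> {linear H -> H}) (Q : seq G) (eps : R) : Prop :=
  exists2 v : H, v != 0 & forall g, g \in Q -> `|rho g v - v| < eps%:C * `|v|.

Definition has_invariant (G : groupType) (H : completeNormedModType R[i])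
    (rho : G -> {linear H -> H}) : Prop :=
  exists2 v : H, v != 0 & forall g, rho g v = v.

(* Existence of a Kazhdan pair (Q, eps), with Q finite because the compact
   subsets of a discrete group are the finite ones. *)
Definition property_T (G : groupType) : Prop :=
  exists (Q : seq G) (eps : R), 0 < eps /\
    forall (H : completeNormedModType R[i]) (dot : {dot H for Num.conj})
           (rho : G -> {linear H -> H}),
      induces_norm dot -> unitary_rep dot rho ->
      has_almost_invariant rho Q eps -> has_invariant rho.

End PropertyT.

Section Random.
Local Open Scope ring_scope.
Variable R : realType.

Definition unif_prob (T : finType) (E : T -> Prop) : R :=
  #|[set x : T | `[< E x >]]|%:R / #|T|%:R.

Definition cyc_reduced_word (m k : nat) : finType :=
  {w : k.-tuple (letter 'I_m) | cyclically_reduced w}.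

(* The argument of truncn is nonnegative, so truncn is the floor. *)
Definition num_relators (m : nat) (d : R) : nat :=
  Num.truncn ((2 * m - 1)%N%:R `^ (3 * d)).

(* Independent uniform relators amount to a uniform tuple of relators. *)
Definition relator_tuple (m : nat) (d : R) : finType :=
  (num_relators m d).-tuple (cyc_reduced_word m 3).

Definition triangular_group (m : nat) (d : R) (r : relator_tuple m d)
    : groupType :=
  presented [seq tval (val w) : word 'I_m | w <- tval r].

End Random.

(* Main.v *)
Require Import Defs.
From mathcomp Require Import all_boot all_order all_algebra.
From mathcomp Require Import all_classical all_reals all_analysis.
From mathcomp Require Import complex ring lra.
Import Order.TTheory GRing.Theory Num.Theory.
Import numFieldNormedType.Exports.

(* A unitary representation [rho] and a vector [v] give the function
   [b a := rho a v - v] on letters.  A relation [xyz = 1] turns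
   [|rho y v - rho x^-1 v|] into [|b z|], so summing over the edges of the link
   yields [<A b, b> = sum_a T_a |b a|^2], where [A] is the adjacency matrix of the
   link and [T_a] counts the occurrences of the letter [a] in the relators.
   Splitting [A] into its mean (essentially a multiple of the all-ones matrix) and
   a noise [B] with [|B| <= min_a T_a / 2] gives the Kazhdan-type inequality
   [sum_a |b a|^2 <= kappa |sum_a b a|^2], and iterating [v |-> v - Delta v / 2]
   then moves an almost invariant vector to a nonzero invariant one.

   The bound on [B] comes from the moment method.  Each relator contributes an
   independent centred matrix, so in [E tr (B^2K)] only the words in the relators
   without isolated index survive; they involve at most [K] distinct relators, each
   costing a factor [O(n / N)], where [n] is the number of relators and [N = 2m] the
   number of letters.  Hence [E tr (B^2K) = O(N (n / N)^K)], which is negligible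
   against [(c n / N)^2K] once [(n / N)^K >> N]: since [n / N] is at least a fixed
   positive power of [N] when [d > 1/3], a fixed large [K] suffices. *)

Set Implicit Arguments.
Unset Strict Implicit.
Unset Printing Implicit Defensive.
Local Open Scope ring_scope.

(** * Quadratic forms with values in an inner product space *)

Section RealInnerProduct.
Local Open Scope complex_scope.
Variables (R : realType) (H : lmodType R[i]) (ip : H -> H -> R).
Hypothesis ipDl : forall u v w, ip (u + v) w = ip u w + ip v w.
Hypothesis ipZl : forall (c : R) u v, ip (c%:C *: u) v = c * ip u v.
Hypothesis ipC : forall u v, ip u v = ip v u.
Hypothesis ip_ge0 : forall u, 0 <= ip u u.

Lemma ipDr u v w : ip u (v + w) = ip u v + ip u w.
Proof. by rewrite ipC ipDl ![ip _ u]ipC. Qed.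

Lemma ipZr (c : R) u v : ip u (c%:C *: v) = c * ip u v.
Proof. by rewrite ipC ipZl [ip v u]ipC. Qed.

Lemma ip0l u : ip 0 u = 0.
Proof. by apply: (addrI (ip 0 u)); rewrite -ipDl !addr0. Qed.

Lemma ipNl u v : ip (- u) v = - ip u v.
Proof. by apply: (addrI (ip u v)); rewrite -ipDl !subrr ip0l. Qed.

Lemma ipNr u v : ip u (- v) = - ip u v.
Proof. by rewrite ipC ipNl ipC. Qed.

Lemma ip_suml (I : finType) (F : I -> H) u :
  ip (\sum_i F i) u = \sum_i ip (F i) u.
Proof. by apply: (big_morph (fun x => ip x u)) => [v w|]; rewrite ?ipDl ?ip0l. Qed.

Lemma ip_sumr (I : finType) (F : I -> H) u :
  ip u (\sum_i F i) = \sum_i ip u (F i).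
Proof. by rewrite ipC ip_suml; apply: eq_bigr => i _; rewrite ipC. Qed.

Lemma ip_sqrB u v : ip (u - v) (u - v) = ip u u + ip v v - 2 * ip u v.
Proof. by rewrite ipDl !ipDr !ipNl !ipNr [ip v u]ipC; ring. Qed.

(** Lagrange's identity: twice the gap between the two sides is the sum of [|c i f j - c j f i|^2]
    over all pairs. *)
Lemma ip_sqr_sum_le (I : finType) (c : I -> R) (f : I -> H) :
  ip (\sum_i (c i)%:C *: f i) (\sum_i (c i)%:C *: f i) <=
  (\sum_i c i ^+ 2) * \sum_i ip (f i) (f i).
Proof.
have E : \sum_i \sum_j ip ((c i)%:C *: f j - (c j)%:C *: f i)
                         ((c i)%:C *: f j - (c j)%:C *: f i) =
   2 * ((\sum_i c i ^+ 2) * \sum_i ip (f i) (f i)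
      - ip (\sum_i (c i)%:C *: f i) (\sum_i (c i)%:C *: f i)).
  under eq_bigr => i _ do under eq_bigr => j _ do
    rewrite ip_sqrB !ipZl !ipZr.
  under eq_bigr => i _ do rewrite !big_split /=.
  rewrite !big_split /=.
  have E1 : \sum_i \sum_j c i * (c i * ip (f j) (f j)) =
            (\sum_i c i ^+ 2) * \sum_i ip (f i) (f i).
    rewrite mulr_suml; apply: eq_bigr => i _; rewrite mulr_sumr.
    by apply: eq_bigr => j _; rewrite expr2 mulrA.
  have E2 : \sum_i \sum_j c j * (c j * ip (f i) (f i)) =
            (\sum_i c i ^+ 2) * \sum_i ip (f i) (f i).
    by rewrite exchange_big E1.
  rewrite E1 E2 ip_suml.
  have -> : \sum_i ip ((c i)%:C *: f i) (\sum_j (c j)%:C *: f j)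
    = \sum_i \sum_j c i * (c j * ip (f j) (f i)).
    apply: eq_bigr => i _; rewrite ip_sumr; apply: eq_bigr => j _.
    by rewrite ipZl ipZr [ip (f i) _]ipC.
  under [X in _ + _ + X = _]eq_bigr => i _ do rewrite sumrN.
  rewrite sumrN.
  under [X in _ + _ - X = _]eq_bigr => i _ do rewrite -mulr_sumr.
  rewrite -mulr_sumr; ring.
rewrite -subr_ge0 -(pmulr_rge0 _ (ltr0n R 2)) -E.
by apply: sumr_ge0 => i _; apply: sumr_ge0.
Qed.

(* Replacing [B, theta] by [B ^+ 2, theta ^+ 2] reduces to the Hilbert-Schmidt
   bound [j = 0], which avoids diagonalising [B]. *)
Lemma ip_mulmx_le_trace (n : nat) (B : 'M[R]_n) (f : 'I_n -> H) (j : nat)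
    (theta : R) :
  B^T = B -> 0 < theta -> \tr (B ^+ (2 ^ j.+1)) <= theta ^+ (2 ^ j.+1) ->
  \sum_a \sum_b B a b * ip (f a) (f b) <= theta * \sum_a ip (f a) (f a).
Proof.
move=> Bsym theta_gt0 trB.
pose g (M : 'M[R]_n) a := \sum_b (M a b)%:C *: f b.
pose nf := \sum_a ip (f a) (f a).
have nf_ge0 : 0 <= nf by apply: sumr_ge0.
have quadE (M : 'M[R]_n) :
    \sum_a \sum_b M a b * ip (f a) (f b) = \sum_a ip (g M a) (f a).
  apply: eq_bigr => a _; rewrite ip_suml; apply: eq_bigr => b _.
  by rewrite ipZl ipC.
(* Expanding [|M f - t f|^2 >= 0] turns a bound on [|M f|] into one on [<M f, f>] without square
   roots. *)
have quad (M : 'M[R]_n) (t : R) : 0 < t ->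
    \sum_a ip (g M a) (g M a) <= t ^+ 2 * nf ->
    \sum_a \sum_b M a b * ip (f a) (f b) <= t * nf.
  move=> t_gt0 le; rewrite quadE.
  have : 0 <= \sum_a ip (g M a - t%:C *: f a) (g M a - t%:C *: f a).
    by apply: sumr_ge0.
  under eq_bigr => a _ do rewrite ip_sqrB !ipZl !ipZr.
  rewrite !big_split /= sumrN -!mulr_sumr -/nf => ge0.
  rewrite -(ler_pM2l t_gt0); nra.
apply: (quad) => //; rewrite -/nf.
elim: j B theta Bsym theta_gt0 trB => [|j IH] B theta Bsym theta_gt0 trB.
  (* For symmetric [B] the trace of [B ^+ 2] is the sum of the squared entries, and Cauchy-Schwarz
     applies row by row. *)
  rewrite expn1 in trB.
  apply: (@le_trans _ _ (\sum_a (\sum_b B a b ^+ 2) * nf)).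
    by apply: ler_sum => a _; exact: ip_sqr_sum_le.
  rewrite -mulr_suml ler_wpM2r//; apply: le_trans trB.
  rewrite /mxtrace; apply: ler_sum => a _.
  rewrite expr2 -mulmxE mxE; apply: ler_sum => b _.
  by rewrite expr2 -{4}Bsym mxE.
have B2sym : (B ^+ 2)^T = B ^+ 2.
  by rewrite expr2 -mulmxE trmx_mul Bsym.
(* Symmetry gives [|B f|^2 = <B^2 f, f>], so the induction hypothesis for [B ^+ 2] takes over. *)
have -> : \sum_a ip (g B a) (g B a) =
    \sum_a \sum_b (B ^+ 2) a b * ip (f a) (f b).
  rewrite quadE.
  transitivity (\sum_a \sum_b \sum_c B a b * (B a c * ip (f b) (f c))).
    apply: eq_bigr => a _; rewrite ip_suml; apply: eq_bigr => b _.
    rewrite ip_sumr; apply: eq_bigr => c _; by rewrite ipZl ipZr.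
  transitivity (\sum_b \sum_c (B ^+ 2) b c * ip (f b) (f c)).
    rewrite exchange_big; apply: eq_bigr => b _ /=.
    rewrite exchange_big; apply: eq_bigr => c _ /=.
    rewrite expr2 -mulmxE mxE mulr_suml; apply: eq_bigr => a _.
    by rewrite -[in RHS]Bsym mxE Bsym mulrA.
  apply: eq_bigr => b _; rewrite ip_suml; apply: eq_bigr => c _.
  by rewrite ipZl ipC.
apply: (quad); first exact: exprn_gt0.
apply: IH => //; first exact: exprn_gt0.
by rewrite -!exprM -!expnS.
Qed.

End RealInnerProduct.

(** * Moments of sums of independent centred matrices *)

Section Words.
Variable n : nat.

Definition distinct (s : seq 'I_n) : nat := size (undup s).

Fixpoint words (L : nat) : seq (seq 'I_n) :=
  if L is L'.+1 then [seq i :: s | i <- enum 'I_n, s <- words L'] else [:: [::]].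

Lemma size_words L s : s \in words L -> size s = L.
Proof.
elim: L s => [|L IH] s /=; first by rewrite inE => /eqP ->.
by case/allpairsP => -[i t] /= [_ /IH <- ->].
Qed.

Lemma distinct_cons i s :
  distinct (i :: s) = if i \in s then distinct s else (distinct s).+1.
Proof. by rewrite /distinct /=; case: (i \in s). Qed.

Lemma distinct_card s : distinct s = #|s|.
Proof.
by rewrite /distinct -(card_uniqP (undup_uniq s)); apply: eq_card => i; rewrite mem_undup.
Qed.

(** A word with [k + 1] distinct indices has a tail with [k + 1] of them, and its head is one of
    these, or a tail with [k] and one of at most [n] new heads. The bound satisfies this
    recursion. *)
Lemma count_words_distinct L k :
  (\sum_(s <- words L) (distinct s == k) <= n ^ k * k.+1 ^ L)%N.
Proof.
elim: L k => [|L IH] k /=.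
  by rewrite big_seq1 /=; case: k => [|k] //=.
rewrite big_allpairs_dep exchange_big /=.
case: k => [|k].
  rewrite big1// => s _; rewrite big1// => i _.
  rewrite distinct_cons; case: ifP => // is_s.
  by rewrite /distinct size_eq0; case: eqP => // us; rewrite -mem_undup us in is_s.
have step s : (\sum_(i <- enum 'I_n) (distinct (i :: s) == k.+1) <=
    k.+1 * (distinct s == k.+1) + n * (distinct s == k))%N.
  rewrite big_enum /=.
  apply: (@leq_trans (\sum_i ((i \in s) * (distinct s == k.+1)
                           + (distinct s == k)))%N).
    apply: leq_sum => i _; rewrite distinct_cons.
    by case: (i \in s) => /=; [rewrite mul1n leq_addr | rewrite eqSS].
  rewrite big_split /= sum_nat_const card_ord leq_add2r -big_distrl /=.
  rewrite -[X in (X * _ <= _)%N](big_mkcond (fun i => i \in s) (fun=> 1%N)) /=.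
  by rewrite sum1_card -distinct_card; case: eqP => [->|_] //; rewrite !muln0.
apply: leq_trans; first by apply: leq_sum => s _; exact: step.
rewrite big_split /= -!big_distrr /=.
apply: leq_trans; first by apply: leq_add; apply: leq_mul (leqnn _) (IH _).
have h : (k.+1 ^ L <= k.+2 ^ L)%N by case: L {IH} => // L; rewrite leq_exp2r.
rewrite [(k.+2 ^ L.+1)%N]expnS [(n ^ k.+1)%N]expnS.
move: (n ^ k)%N (k.+1 ^ L)%N (k.+2 ^ L)%N h => a b c h.
have -> : (k.+1 * (n * a * c) + n * (a * b) = n * a * (k.+1 * c + b))%N by ring.
by rewrite leq_mul2l [(k.+2 * c)%N]mulSn addnC leq_add2r h orbT.
Qed.

(** Every index that occurs does so at least twice, and the multiplicities add up to the length. *)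
Lemma distinct_le_half s : (forall i, i \in s -> count_mem i s != 1%N) ->
  (2 * distinct s <= size s)%N.
Proof.
move=> cs; rewrite distinct_card.
have -> : size s = \sum_(i : 'I_n) count_mem i s.
  elim: s {cs} => [|j s IH] /=; first by rewrite big1.
  rewrite big_split /= -IH (bigD1 j) //= eqxx big1 ?addn0// => i.
  by rewrite eq_sym => /negbTE ->.
rewrite mulnC -sum_nat_const big_mkcond /=; apply: leq_sum => i _.
case: ifP => // is_s; have := cs i is_s.
move: is_s; rewrite -has_pred1 has_count.
by case: (count _ s) => [|[|c]].
Qed.

End Words.

(** * Moment bound for a sum over independent uniform samples *)

Section Moments.
Variables (R : realFieldType) (W : finType) (n : nat).

Definition resample (r : n.-tuple W) (i : 'I_n) (w : W) : n.-tuple W :=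
  [tuple if j == i then w else tnth r j | j < n].

(** Exchanging entry [i] with the extra sample is an involution on pairs [(r, w)]. This is
    independence in counting form: entry [i] can be averaged separately. *)
Lemma sum_resample (V : nmodType) (F : n.-tuple W -> V) (i : 'I_n) :
  (\sum_r F r) *+ #|W| = \sum_r \sum_w F (resample r i w).
Proof.
rewrite pair_bigA /=.
pose h (p : n.-tuple W * W) := (resample p.1 i p.2, tnth p.1 i).
have hK : involutive h.
  case=> r w; rewrite /h /= tnth_mktuple eqxx; congr (_, _).
  apply: eq_from_tnth => j; rewrite !tnth_mktuple.
  by case: eqP => // ->.
rewrite -sumrMnl (eq_bigr (fun r => \sum_(w : W) F r)).
  by rewrite pair_bigA /= (reindex_inj (inv_inj hK)).
by move=> r _; rewrite sumr_const.
Qed.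

Section WordMatrix.
Variable k : nat.

(* The factors come in reverse order, so that the head of [s] can be peeled off on
   the right, next to the all-ones vector. *)
Definition wordmx (Y : W -> 'M[R]_k) (s : seq 'I_n) (r : n.-tuple W) : 'M[R]_k :=
  foldr (fun i P => P *m Y (tnth r i)) 1%:M s.

Lemma wordmx_resample Y s r i w : i \notin s ->
  wordmx Y s (resample r i w) = wordmx Y s r.
Proof.
elim: s => //= j s IH; rewrite inE negb_or => /andP[ij /IH ->].
by rewrite tnth_mktuple eq_sym (negbTE ij).
Qed.

Lemma wordmx_cat Y s1 s2 r :
  wordmx Y (s1 ++ s2) r = wordmx Y s2 r *m wordmx Y s1 r.
Proof.
elim: s1 => [|i s1 IH] /=; first by rewrite mulmx1.
by rewrite IH mulmxA.
Qed.

Lemma exp_sum_wordmx Y L (r : n.-tuple W) :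
  (\sum_i Y (tnth r i)) ^+ L = \sum_(s <- words n L) wordmx Y s r.
Proof.
elim: L => [|L IH]; first by rewrite expr0 big_seq1.
rewrite exprSr IH /= big_allpairs_dep exchange_big /= mulr_suml.
apply: eq_bigr => s _; rewrite mulr_sumr big_enum /=.
by apply: eq_bigr => i _; rewrite mulmxE.
Qed.

Variables (Y M : W -> 'M[R]_k) (C x : R).
Hypothesis W_gt0 : (0 < #|W|)%N.
Hypothesis x_ge0 : 0 <= x.
Hypothesis Y_centered : \sum_w Y w = 0.
Hypothesis Y_le : forall w a b, `|Y w a b| <= M w a b.
Hypothesis M_row : forall w a, \sum_b M w a b <= C.
Hypothesis M_mean : forall a, \sum_w \sum_b M w a b <= #|W|%:R * (C * x).

(** Resampling an index that occurs once changes a single factor of the product, and that factor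
    averages to zero. *)
Lemma sum_wordmx_eq0 s i : count_mem i s = 1%N -> \sum_r wordmx Y s r = 0.
Proof.
move=> ci; have is_s : i \in s by rewrite -has_pred1 has_count ci.
case/splitPr: is_s ci => s1 s2; rewrite count_cat /= eqxx => ci.
have /andP[c1 c2] : (count_mem i s1 == 0%N) && (count_mem i s2 == 0%N).
  by rewrite -addn_eq0 -eqSS -add1n addnCA ci.
have i1 : i \notin s1 by rewrite -has_pred1 has_count -eqn0Ngt.
have i2 : i \notin s2 by rewrite -has_pred1 has_count -eqn0Ngt.
have : (\sum_r wordmx Y (s1 ++ i :: s2) r) *+ #|W| = 0.
  rewrite (sum_resample _ i) big1// => r _.
  under eq_bigr => w _ do
    rewrite wordmx_cat /= !wordmx_resample// tnth_mktuple eqxx.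
  by rewrite -mulmx_suml -mulmx_sumr Y_centered mulmx0 mul0mx.
move=> /matrixP E; apply/matrixP => a b; have := E a b.
by rewrite mulmxnE mxE => /eqP; rewrite mulrn_eq0 eqn0Ngt W_gt0 /= => /eqP.
Qed.

Lemma wordmx_norm_le s r a b : `|wordmx Y s r a b| <= wordmx M s r a b.
Proof.
elim: s a b => [|i s IH] a b /=; first by rewrite mxE; case: (_ == _); rewrite ?normr1 ?normr0.
rewrite !mxE; apply: le_trans (ler_norm_sum _ _ _) _; apply: ler_sum => c _.
by rewrite normrM ler_pM.
Qed.

(* A relator that already occurred costs the maximal row sum [C], a new one only
   the mean row sum [C * x]. *)
Lemma sum_wordmx_le s a : 0 <= C ->
  \sum_r \sum_b wordmx M s r a b <= #|{: n.-tuple W}|%:R * (C ^+ size s * x ^+ distinct s).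
Proof.
move=> C_ge0.
have P_ge0 t r c : 0 <= wordmx M t r a c.
  exact: le_trans (wordmx_norm_le t r a c).
elim: s => [|i s IH] /=.
  rewrite /distinct /= !expr0 !mulr1 -sumr_const ler_sum// => r _.
  rewrite (bigD1 a)//= mxE eqxx big1 ?addr0// => b /negbTE ba.
  by rewrite mxE eq_sym ba.
have rowE r : \sum_b (wordmx M s r *m M (tnth r i)) a b =
    \sum_c wordmx M s r a c * \sum_b M (tnth r i) c b.
  under eq_bigr => b _ do rewrite mxE.
  by rewrite exchange_big; apply: eq_bigr => c _; rewrite mulr_sumr.
under eq_bigr => r _ do rewrite rowE.
rewrite distinct_cons; case: ifPn => is_s.
  apply: (@le_trans _ _ (\sum_r \sum_c wordmx M s r a c * C)).
    by apply: ler_sum => r _; apply: ler_sum => c _; rewrite ler_wpM2l.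
  under eq_bigr => r _ do rewrite -mulr_suml.
  rewrite -mulr_suml exprS.
  apply: le_trans (ler_wpM2r C_ge0 IH) _.
  by rewrite le_eqVlt; apply/orP; left; apply/eqP; ring.
(* The index [i] does not occur in [s], so its entry can be averaged on its own, which brings in the
   mean row sum. *)
have W0 : 0 < (#|W|%:R : R) by rewrite ltr0n.
rewrite -(ler_pM2l W0) [leLHS]mulr_natl (sum_resample _ i).
apply: (@le_trans _ _ (\sum_r \sum_c wordmx M s r a c * (#|W|%:R * (C * x)))).
  apply: ler_sum => r _.
  under eq_bigr => w _ do (rewrite wordmx_resample// tnth_mktuple eqxx).
  rewrite exchange_big; apply: ler_sum => c _ /=.
  by rewrite -mulr_sumr ler_wpM2l.
under eq_bigr => r _ do rewrite -mulr_suml.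
rewrite -mulr_suml !exprS.
have W1 : 0 <= #|W|%:R * (C * x) by rewrite !mulr_ge0.
apply: le_trans (ler_wpM2r W1 IH) _.
by rewrite le_eqVlt; apply/orP; left; apply/eqP; ring.
Qed.

(** Words with an isolated index cancel, and all others have at most [K] distinct indices. Since
    [1 <= n%:R * x], the contribution of exactly [K] distinct indices dominates those of fewer. *)
Lemma moment_bound (K : nat) (a : 'I_k) : 0 <= C -> 1 <= n%:R * x ->
  \sum_(r : n.-tuple W) ((\sum_i Y (tnth r i)) ^+ (2 * K)) a a <=
  #|{: n.-tuple W}|%:R *
    (C ^+ (2 * K) * (K.+1%:R ^+ (2 * K).+1 * (n%:R * x) ^+ K)).
Proof.
move=> C_ge0 nx1.
set Om := #|_|.
have -> : \sum_(r : n.-tuple W) ((\sum_i Y (tnth r i)) ^+ (2 * K)) a a =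
    \sum_(s <- words n (2 * K)) (\sum_r wordmx Y s r) a a.
  under eq_bigr => r _ do rewrite exp_sum_wordmx summxE.
  by rewrite exchange_big; apply: eq_bigr => s _; rewrite summxE.
(* [wt s] is [x ^+ distinct s] when [distinct s <= K] and zero otherwise; as a sum over [j] it lets
   the words be counted by their number of distinct indices. *)
pose wt (s : seq 'I_n) : R := \sum_(j < K.+1) (distinct s == j)%:R * x ^+ j.
have wt_ge0 s : 0 <= wt s by apply: sumr_ge0 => j _; rewrite mulr_ge0 ?exprn_ge0.
apply: (@le_trans _ _ (\sum_(s <- words n (2 * K)) Om%:R * (C ^+ (2 * K) * wt s))).
  rewrite big_seq [leRHS]big_seq; apply: ler_sum => s /size_words sz.
  have [/hasP[i is_s /eqP ci]|/hasPn noi] := boolP (has (fun i => count_mem i s == 1%N) s).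
    by rewrite (sum_wordmx_eq0 ci) mxE !mulr_ge0 ?exprn_ge0.
  have dK : (distinct s < K.+1)%N.
    by rewrite ltnS -(leq_pmul2l (isT : (0 < 2)%N)) -sz distinct_le_half.
  have -> : wt s = x ^+ distinct s.
    rewrite /wt (bigD1 (Ordinal dK))//= eqxx mul1r big1 ?addr0// => j jd.
    case: eqP => [E|]; last by rewrite mul0r.
    by case/eqP: jd; apply: val_inj; rewrite /= E.
  rewrite -sz; apply: le_trans (sum_wordmx_le s a C_ge0).
  rewrite summxE; apply: ler_sum => r _.
  apply: (le_trans (ler_norm _)); apply: (le_trans (wordmx_norm_le _ _ _ _)).
  rewrite (bigD1 a)//= lerDl; apply: sumr_ge0 => b _.
  exact: le_trans (wordmx_norm_le s r a b).
rewrite -mulr_sumr ler_wpM2l// -mulr_sumr ler_wpM2l ?exprn_ge0//.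
rewrite exchange_big /=.
(* One of the [2K + 1] factors [K + 1] pays for the number of values of [j]. *)
have -> : K.+1%:R ^+ (2 * K).+1 * (n%:R * x) ^+ K =
    \sum_(j < K.+1) K.+1%:R ^+ (2 * K) * (n%:R * x) ^+ K.
  by rewrite sumr_const card_ord exprS -mulrA [LHS]mulr_natl.
apply: ler_sum => j _.
rewrite -mulr_suml -natr_sum.
apply: (@le_trans _ _ ((n ^ j * j.+1 ^ (2 * K))%:R * x ^+ j)).
  by rewrite ler_wpM2r ?exprn_ge0// ler_nat count_words_distinct.
rewrite natrM !natrX mulrAC -exprMn mulrC.
have j_le : (j <= K)%N by rewrite -ltnS.
apply: ler_pM; rewrite ?exprn_ge0 ?mulr_ge0//.
  by rewrite lerXn2r ?nnegrE// ler_nat ltnS.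
exact: ler_weXn2l.
Qed.

End WordMatrix.
End Moments.

(** * Property (T) from a Kazhdan-type inequality *)

Section Geometric.
Local Open Scope complex_scope.
Variable R : realType.

Lemma geometric_small (D s e : R) : 0 <= D -> 0 <= s -> s < 1 -> 0 < e ->
  exists N, D * s ^+ N < e.
Proof.
move=> D_ge0 s_ge0 s_lt1 e_gt0.
have /cvg_ballP/(_ e e_gt0)[N _ /(_ N (leqnn N))] :=
  @cvg_geometric _ D s (etrans (congr1 (fun x => x < 1) (ger0_norm s_ge0)) s_lt1).
rewrite -ball_normE /= sub0r normrN ger0_norm ?mulr_ge0 ?exprn_ge0// => h.
by exists N.
Qed.

(** The distance to the limit is at most the tail of a geometric series. The explicit rate is what
    later keeps the limit away from zero. *)
Lemma geometric_cvg (H : completeNormedModType R[i]) (u : nat -> H) (C s : R) :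
  0 <= C -> 0 <= s -> s < 1 ->
  (forall k, `|u k.+1 - u k| <= (C * s ^+ k)%:C) ->
  exists l, forall k, `|l - u k| <= (C / (1 - s) * s ^+ k)%:C.
Proof.
move=> C_ge0 s_ge0 s_lt1 step.
set D := C / (1 - s).
have s1 : 0 < 1 - s by rewrite subr_gt0.
have D_ge0 : 0 <= D by rewrite divr_ge0// ltW.
have tail k j : `|u (k + j)%N - u k| <= (D * s ^+ k * (1 - s ^+ j))%:C.
  elim: j => [|j IH]; first by rewrite addn0 subrr normr0 expr0 subrr mulr0.
  rewrite addnS -(subrKA (u (k + j)%N)) (le_trans (ler_normD _ _))//.
  apply: le_trans (lerD (step _) IH) _.
  rewrite -rmorphD lecR /= le_eqVlt; apply/orP; left; apply/eqP.
  by rewrite /D exprD exprS; field; rewrite gt_eqF.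
have dist k j : (k <= j)%N -> `|u j - u k| <= (D * s ^+ k)%:C.
  move=> kj; rewrite -(subnKC kj); apply: le_trans (tail _ _) _.
  rewrite lecR; apply: ler_piMr; first by rewrite mulr_ge0// exprn_ge0.
  by rewrite lerBlDr lerDl exprn_ge0.
(* Positivity in [R[i]] forces a zero imaginary part, so the tolerance is real. *)
have small (e : R[i]) : 0 < e -> exists N, (D * s ^+ N)%:C < e.
  case: e => a b; rewrite ltcE /= => /andP[/eqP -> a_gt0].
  have [N hN] := geometric_small D_ge0 s_ge0 s_lt1 a_gt0.
  by exists N; rewrite ltcR.
have : cvg (u @ \oo)%classic.
  apply/cauchy_cvgP/cauchy_exP => e e_gt0.
  have [N hN] := small e e_gt0.
  exists (u N); exists N => // j /= Nj.
  by rewrite -ball_normE /= distrC (le_lt_trans (dist _ _ Nj)).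
move=> /cvg_ex[l ul]; exists l => k.
apply/ler_addgt0Pr => e e_gt0.
have /cvgrPdist_lt/(_ e e_gt0)[N _ hN] := ul.
rewrite -(subrKA (u (maxn N k))) (le_trans (ler_normD _ _))// addrC lerD//.
  by rewrite dist// leq_maxr.
by apply/ltW/hN; rewrite /= leq_maxl.
Qed.

End Geometric.

Section HilbertRealPart.
Local Open Scope complex_scope.
Variables (R : realType) (H : completeNormedModType R[i])
  (dot : {dot H for Num.conj}).
Hypothesis dotN : induces_norm dot.

(** The real part of the Hermitian product is a real inner product with the same norm, which moves
    all estimates to [R]. *)
Definition re_dot (u v : H) : R := complex.Re (dot u v).

Definition re_norm (v : H) : R := complex.Re `|v|.

Lemma re_dotDl u v w : re_dot (u + v) w = re_dot u w + re_dot v w.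
Proof.
have ReD (x y : R[i]) : complex.Re (x + y) = complex.Re x + complex.Re y.
  by case: x y => [a b] [c d].
by rewrite /re_dot linearDl ReD.
Qed.

Lemma re_dotZl (c : R) u v : re_dot (c%:C *: u) v = c * re_dot u v.
Proof.
have ReM (x : R[i]) : complex.Re (c%:C * x) = c * complex.Re x.
  by case: x => [a b] /=; rewrite mul0r subr0.
by rewrite /re_dot linearZl_LR ReM.
Qed.

Lemma re_dotC u v : re_dot u v = re_dot v u.
Proof.
have ReJ (x : R[i]) : complex.Re (Num.conj x) = complex.Re x by case: x.
by rewrite /re_dot hermC /= expr0 mul1r ReJ.
Qed.

Lemma re_normE v : `|v| = (re_norm v)%:C.
Proof. by rewrite /re_norm RRe_real// ger0_real. Qed.

Lemma re_norm_ge0 v : 0 <= re_norm v.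
Proof. by rewrite -ler0c -re_normE. Qed.

Lemma re_dotE v : re_dot v v = re_norm v ^+ 2.
Proof. by rewrite /re_dot -dotN re_normE -rmorphXn. Qed.

Lemma re_dot_ge0 v : 0 <= re_dot v v.
Proof. by rewrite re_dotE sqr_ge0. Qed.

Lemma re_norm_le v (c : R) : 0 <= c -> re_dot v v <= c ^+ 2 -> `|v| <= c%:C.
Proof.
move=> c_ge0; rewrite re_dotE re_normE lecR => h.
by rewrite -(@ler_pXn2r _ 2)// nnegrE ?re_norm_ge0.
Qed.

End HilbertRealPart.

(** * From the inequality to an invariant vector *)

Section KazhdanCriterion.
Local Open Scope complex_scope.
Variables (R : realType) (G : groupType) (V : finType) (gen : V -> G)
  (bar : V -> V) (kappa : R).
Hypothesis barK : involutive bar.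
Hypothesis gen_bar : forall a, (gen (bar a) * gen a)%g = 1%g.
Hypothesis gen_ind : forall P : G -> Prop, P 1%g ->
  (forall a g, P g -> P (gen a * g)%g) -> forall g, P g.
Hypothesis V_gt0 : (0 < #|V|)%N.

Section Iteration.
Variables (H : completeNormedModType R[i]) (dot : {dot H for Num.conj})
  (rho : G -> {linear H -> H}).
Hypotheses (dotN : induces_norm dot) (rhoU : unitary_rep dot rho).
Hypothesis kazhdan_ineq : forall v,
  \sum_a re_dot dot (rho (gen a) v - v) (rho (gen a) v - v) <=
  kappa * re_dot dot (\sum_a (rho (gen a) v - v)) (\sum_a (rho (gen a) v - v)).

Let ip := re_dot dot.
Let ipDl u v w : ip (u + v) w = ip u w + ip v w. Proof. exact: re_dotDl. Qed.
Let ipZl (c : R) u v : ip (c%:C *: u) v = c * ip u v. Proof. exact: re_dotZl. Qed.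
Let ipC u v : ip u v = ip v u. Proof. exact: re_dotC. Qed.
Let ip_ge0 u : 0 <= ip u u. Proof. exact: re_dot_ge0. Qed.
Let N : R := #|V|%:R.

Let N_gt0 : 0 < N. Proof. by rewrite ltr0n. Qed.

Let sum_const (c : R) : \sum_(a : V) c = N * c.
Proof. by rewrite sumr_const mulr_natl. Qed.

Let rho_iso a u v : ip (rho (gen a) u) (rho (gen a) v) = ip u v.
Proof. by case: rhoU => _ _ iso; rewrite /ip /re_dot iso. Qed.

Let rho_bar a v : rho (gen (bar a)) (rho (gen a) v) = v.
Proof. by case: rhoU => r1 rM _; rewrite -rM gen_bar r1. Qed.

Let rho_adj a u v : ip (rho (gen a) u) v = ip u (rho (gen (bar a)) v).
Proof. by rewrite -[in LHS](rho_bar (bar a) v) barK rho_iso. Qed.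

(** The identity minus the average of the generators; with this normalisation its quadratic form
    lies between [0] and [2 |v|^2]. *)
Definition laplacian (v : H) : H := \sum_a (N^-1)%:C *: (v - rho (gen a) v).

Definition energy (v : H) : R := ip (laplacian v) v.

Let displacement v := \sum_a ip (rho (gen a) v - v) (rho (gen a) v - v).

Lemma energyE v : energy v = (2 * N)^-1 * displacement v.
Proof.
rewrite /energy /displacement (ip_suml ipDl) mulr_sumr; apply: eq_bigr => a _.
rewrite ipZl ipDl (ipNl ipDl) (ip_sqrB ipDl ipC) rho_iso -/ip.
by field; rewrite gt_eqF.
Qed.

Lemma energy_ge0 v : 0 <= energy v.
Proof.
by rewrite energyE mulr_ge0 ?invr_ge0 ?mulr_ge0 ?(ltW N_gt0)// sumr_ge0.
Qed.

(** Cauchy-Schwarz with constant weights [N^-1]. *)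
Lemma sqr_laplacian_le v : ip (laplacian v) (laplacian v) <= 2 * energy v.
Proof.
rewrite /laplacian.
apply: le_trans (ip_sqr_sum_le ipDl ipZl ipC ip_ge0 (fun=> N^-1) _) _.
rewrite sum_const -/ip energyE le_eqVlt; apply/orP; left; apply/eqP.
have -> : \sum_a ip (v - rho (gen a) v) (v - rho (gen a) v) = displacement v.
  apply: eq_bigr => a _.
  by rewrite -opprB (ipNl ipDl) (ipNr ipDl ipC) opprK.
by field; rewrite gt_eqF.
Qed.

Lemma energy_le v : energy v <= 2 * ip v v.
Proof.
rewrite energyE -ler_pdivlMl ?invr_gt0 ?mulr_gt0// invrK.
have -> : 2 * N * (2 * ip v v) = \sum_(a : V) 4 * ip v v.
  by rewrite sum_const; ring.
apply: ler_sum => a _.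
have := ip_ge0 (rho (gen a) v + v).
rewrite (ip_sqrB ipDl ipC) ipDl !(ipDr ipDl ipC) -/ip !rho_iso.
rewrite [ip v (rho _ v)]ipC; lra.
Qed.

Let lapB u v : laplacian (u - v) = laplacian u - laplacian v.
Proof.
rewrite /laplacian -sumrB; apply: eq_bigr => a _.
rewrite -scalerBr; congr (_ *: _).
by rewrite (linearB (rho (gen a))) /= !opprB addrACA [- v + _]addrC addrACA.
Qed.

Let lapZ (c : R) v : laplacian (c%:C *: v) = c%:C *: laplacian v.
Proof.
rewrite /laplacian scaler_sumr; apply: eq_bigr => a _.
by rewrite linearZ_LR -scalerBr !scalerA mulrC.
Qed.

(** The adjoint of a generator is its inverse, and [bar] permutes the generators. *)
Lemma laplacian_sym u v : ip (laplacian u) v = ip u (laplacian v).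
Proof.
rewrite (ip_suml ipDl) (ip_sumr ipDl ipC).
transitivity (\sum_a (N^-1 * ip u v - N^-1 * ip (rho (gen a) u) v)).
  by apply: eq_bigr => a _; rewrite ipZl ipDl (ipNl ipDl) mulrBr.
transitivity (\sum_a (N^-1 * ip u v - N^-1 * ip u (rho (gen a) v))).
  rewrite !sumrB; congr (_ - _).
  rewrite [RHS](reindex_inj (inv_inj barK)) /=.
  by apply: eq_bigr => a _; rewrite rho_adj.
apply: eq_bigr => a _.
by rewrite (ipZr ipZl ipC) (ipDr ipDl ipC) (ipNr ipDl ipC) mulrBr.
Qed.

Definition step (v : H) : H := v - (2^-1)%:C *: laplacian v.

(** The cross terms give [- |Delta v|^2], and the remaining [energy (laplacian v) / 4] returns at
    most half of it by [energy_le]. *)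
Lemma energy_step v :
  energy (step v) <= energy v - 2^-1 * ip (laplacian v) (laplacian v).
Proof.
have -> : energy (step v) = energy v - ip (laplacian v) (laplacian v)
    + 4^-1 * energy (laplacian v).
  rewrite /energy /step lapB lapZ ipDl (ipNl ipDl) ipZl.
  rewrite !(ipDr ipDl ipC) !(ipNr ipDl ipC) !(ipZr ipZl ipC) -/ip.
  rewrite [ip (laplacian (laplacian v)) v]laplacian_sym; lra.
have := energy_le (laplacian v); lra.
Qed.

(** The energy contracts by [s ^+ 2] at each step, so the iterates converge geometrically. Small
    initial energy makes the whole path shorter than [|v|], hence the limit is nonzero. *)
Lemma invariant_of_almost_invariant (K : R) (Q := [seq gen a | a <- enum V]) :
  1 <= K -> kappa * N <= K ->
  has_almost_invariant rho Q ((2 * K)^-1) -> has_invariant rho.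
Proof.
move=> K1 kK [v v_neq0 almost].
set e := (2 * K)^-1 in almost.
pose s : R := 1 - e.
have K_gt0 : 0 < K by lra.
have e_gt0 : 0 < e by rewrite invr_gt0 mulr_gt0.
have eK : 2 * (e * K) = 1 by rewrite /e; field; rewrite gt_eqF.
have e_le : e <= 2^-1 by nra.
have s_ge0 : 0 <= s by rewrite /s; lra.
have s_lt1 : s < 1 by rewrite /s; lra.
(* The Kazhdan-type inequality, read with [\sum_a (rho (gen a) u - u) = - N Delta u], is a spectral
   gap. *)
have gap u : energy u <= 2^-1 * K * ip (laplacian u) (laplacian u).
  have := kazhdan_ineq u; rewrite -/ip -/(displacement u).
  have -> : \sum_a (rho (gen a) u - u) = (- N)%:C *: laplacian u.
    rewrite /laplacian scaler_sumr; apply: eq_bigr => a _.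
    rewrite scalerA -rmorphM mulNr mulfV ?gt_eqF// rmorphN1 scaleN1r opprB //.
  rewrite ipZl (ipZr ipZl ipC) -/ip => h.
  rewrite energyE -ler_pdivlMl ?invr_gt0 ?mulr_gt0// invrK.
  apply: (le_trans h); rewrite -subr_ge0.
  have -> : 2 * N * (2^-1 * K * ip (laplacian u) (laplacian u)) -
      kappa * (- N * (- N * ip (laplacian u) (laplacian u))) =
      (K - kappa * N) * (N * ip (laplacian u) (laplacian u)) by field.
  by rewrite !mulr_ge0 ?subr_ge0// ltW.
(* [gap] and [energy_step] give the factor [1 - 2 e], which is at most [(1 - e) ^+ 2]. *)
have decay u : energy (step u) <= s ^+ 2 * energy u.
  have := energy_step u; have := gap u; have := energy_ge0 u.
  have := ip_ge0 (laplacian u); rewrite -/ip /s => h1 h2 h3 h4.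
  have : 2 * e * energy u <= 2^-1 * ip (laplacian u) (laplacian u) by nra.
  have : 0 <= e ^+ 2 * energy u by rewrite mulr_ge0 ?sqr_ge0.
  nra.
pose u k := iter k step v.
have energy_u k : energy (u k) <= (s ^+ k) ^+ 2 * energy v.
  elim: k => [|k IH]; first by rewrite expr0 expr1n mul1r.
  rewrite /u iterS -/(u k); apply: (le_trans (decay _)).
  by rewrite [s ^+ k.+1]exprS exprMn -[leRHS]mulrA ler_wpM2l ?sqr_ge0.
pose t := re_norm v.
have t_gt0 : 0 < t by rewrite -ltcR -re_normE normr_gt0.
have almost_ip a : ip (rho (gen a) v - v) (rho (gen a) v - v) <= (e * t) ^+ 2.
  have := almost (gen a); rewrite map_f ?mem_enum// => /(_ isT).
  rewrite !re_normE -rmorphM ltcR => h.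
  rewrite /ip (re_dotE dotN) lerXn2r ?nnegrE ?re_norm_ge0 ?(ltW h)//.
  by rewrite mulr_ge0// ltW.
have energy_v : energy v <= 2^-1 * (e * t) ^+ 2.
  rewrite energyE -ler_pdivlMl ?invr_gt0 ?mulr_gt0// invrK.
  have -> : 2 * N * (2^-1 * (e * t) ^+ 2) = \sum_(a : V) (e * t) ^+ 2.
    by rewrite sum_const; field.
  exact: ler_sum.
have N1 : 1 <= N by rewrite ler1n.
have sk_ge0 k : 0 <= s ^+ k by exact: exprn_ge0.
have et_ge0 : 0 <= e * t by rewrite mulr_ge0// ltW.
(* Each move is half the Laplacian, of norm at most [e t s ^+ k / 2]; as [1 - s = e], the moves add
   up to at most [t / 2]. *)
have [||l hl] := @geometric_cvg R H u (2^-1 * (e * t)) s _ s_ge0 s_lt1 _.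
- by rewrite mulr_ge0.
- move=> k; apply: (re_norm_le dotN); first by do 2!rewrite mulr_ge0//.
  rewrite /u iterS -/(u k) /step addrAC subrr add0r.
  rewrite -/ip (ipNl ipDl) (ipNr ipDl ipC) opprK ipZl (ipZr ipZl ipC).
  have := sqr_laplacian_le (u k); have := energy_u k; rewrite -/ip => h1 h2.
  have := ler_wpM2l (sqr_ge0 (s ^+ k)) energy_v => h3.
  have -> : (2^-1 * (e * t) * s ^+ k) ^+ 2 =
      2^-1 * (s ^+ k ^+ 2 * (2^-1 * (e * t) ^+ 2)) by field.
  lra.
have lim_dist k : `|l - u k| <= (2^-1 * t * s ^+ k)%:C.
  apply: le_trans (hl k) _; rewrite lecR le_eqVlt; apply/orP; left; apply/eqP.
  have -> : 1 - s = e by rewrite /s; ring.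
  by field; rewrite gt_eqF.
exists l.
  apply/eqP => l0; have := lim_dist 0%N.
  rewrite l0 sub0r normrN expr0 mulr1 re_normE lecR -/t; lra.
apply: gen_ind => [|a g IH]; first by case: rhoU.
have -> : rho (gen a * g)%g l = rho (gen a) l by case: rhoU => _ -> _; rewrite IH.
apply/eqP; rewrite -subr_eq0 -normr_eq0 re_normE -[0]/((0 : R)%:C).
apply/eqP; congr (_%:C); apply/eqP; rewrite eq_le re_norm_ge0 andbT leNgt.
apply/negP => pos.
(* The constant collects two distances [t / 2] between [l] and [u k], and [N e t] for the
   displacement of [u k] by a generator. *)
have [|k hk] := geometric_small (D := t + N * (e * t)) _ s_ge0 s_lt1 pos.
  by rewrite addr_ge0 ?ltW// mulr_gt0// mulr_gt0.
move: hk; apply/negP; rewrite -leNgt -lecR -re_normE.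
have -> : rho (gen a) l - l =
    rho (gen a) (l - u k) + (rho (gen a) (u k) - u k) + (u k - l).
  by rewrite linearB /= !addrA !subrK.
apply: le_trans (ler_normD _ _) _.
apply: le_trans (lerD (ler_normD _ _) (lexx _)) _.
have n1 : `|rho (gen a) (l - u k)| <= (2^-1 * t * s ^+ k)%:C.
  apply: (re_norm_le dotN); first by rewrite !mulr_ge0// ?ltW.
  rewrite -/ip rho_iso /ip (re_dotE dotN) lerXn2r ?nnegrE ?re_norm_ge0//.
    by rewrite !mulr_ge0// ?ltW.
  by rewrite -lecR -re_normE.
have n2 : `|rho (gen a) (u k) - u k| <= (N * (e * t) * s ^+ k)%:C.
  apply: (re_norm_le dotN); first by rewrite !mulr_ge0// ?ltW.
  apply: (@le_trans _ _ (displacement (u k))).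
    by rewrite /displacement (bigD1 a)//= lerDl sumr_ge0.
  have -> : displacement (u k) = 2 * N * energy (u k).
    by rewrite energyE; field; rewrite gt_eqF.
  have h1 := energy_u k; have h2 := ler_wpM2l (sqr_ge0 (s ^+ k)) energy_v.
  have -> : (N * (e * t) * s ^+ k) ^+ 2 =
      N * (N * ((s ^+ k) ^+ 2 * (e * t) ^+ 2)) by ring.
  have -> : 2 * N * energy (u k) = N * (2 * energy (u k)) by ring.
  rewrite ler_wpM2l ?(ltW N_gt0)//.
  have z_ge0 : 0 <= (s ^+ k) ^+ 2 * (e * t) ^+ 2 by rewrite mulr_ge0 ?sqr_ge0.
  have := ler_wpM2r z_ge0 N1; lra.
have n3 : `|u k - l| <= (2^-1 * t * s ^+ k)%:C by rewrite distrC.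
apply: le_trans (lerD (lerD n1 n2) n3) _.
by rewrite -!rmorphD lecR /=; lra.
Qed.

End Iteration.

Lemma property_T_of_kazhdan_ineq :
  (forall (H : completeNormedModType R[i]) (dot : {dot H for Num.conj})
      (rho : G -> {linear H -> H}),
    induces_norm dot -> unitary_rep dot rho -> forall v,
    \sum_a re_dot dot (rho (gen a) v - v) (rho (gen a) v - v) <=
    kappa * re_dot dot (\sum_a (rho (gen a) v - v)) (\sum_a (rho (gen a) v - v))) ->
  property_T R G.
Proof.
(* [K] does not depend on the representation, so one pair serves all of them; [1 <= K] keeps the
   contraction factor nonnegative. *)
move=> ineq; pose K := Num.max 1 (kappa * #|V|%:R).
exists [seq gen a | a <- enum V], ((2 * K)^-1); split.
  by rewrite invr_gt0 mulr_gt0// lt_max ltr01.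
move=> H dot rho dotN rhoU; apply: (invariant_of_almost_invariant dotN rhoU).
- exact: ineq.
- by rewrite le_max lexx.
- by rewrite le_max lexx orbT.
Qed.

End KazhdanCriterion.

(** * Reduced triples and the random link *)

Lemma trmx_exp (R : comNzRingType) n (A : 'M[R]_n) K : A^T = A -> (A ^+ K)^T = A ^+ K.
Proof.
move=> sA; elim: K => [|K IH]; first by rewrite expr0 trmx1.
by rewrite exprS -mulmxE trmx_mul IH sA mulmxE -exprSr exprS.
Qed.

(** The trace is the sum of the squared entries of [A ^+ K]. *)
Lemma mxtrace_exp_even_ge0 (R : realDomainType) n (A : 'M[R]_n) K :
  A^T = A -> 0 <= \tr (A ^+ (2 * K)).
Proof.
move=> sA; rewrite mul2n -addnn exprD -mulmxE /mxtrace sumr_ge0// => i _.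
rewrite mxE sumr_ge0// => j _.
by rewrite -{2}(trmx_exp K sA) mxE -expr2 sqr_ge0.
Qed.

Lemma sumr_cst (R : pzRingType) (T : finType) (c : R) : \sum_(x : T) c = #|T|%:R * c.
Proof. by rewrite sumr_const mulr_natl. Qed.

Section ReducedTriples.
Variables (R : realType) (m : nat).
Hypothesis m_gt1 : (1 < m)%N.
Local Notation V := (letter 'I_m).
Local Notation W := (cyc_reduced_word m 3).
Local Notation N := (#|{: V}|%:R : R).

Definition red (x y : V) : bool := x != letterV y.

Definition let0 (w : W) : V := tnth (val w) (inord 0).
Definition let1 (w : W) : V := tnth (val w) (inord 1).
Definition let2 (w : W) : V := tnth (val w) (inord 2).

Lemma word3E (w : W) : tval (val w) = [:: let0 w; let1 w; let2 w].
Proof.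
rewrite /let0 /let1 /let2; case: w => -[[|x [|y [|z [|? ?]]]] // sz] cr /=.
by rewrite !(tnth_nth x) !inordK.
Qed.

Lemma redC x y : red x y = red y x.
Proof. by rewrite /red -(inj_eq (inv_inj (@letterVK _))) letterVK eq_sym. Qed.

Lemma red_id x : red x x.
Proof. by case: x => s [] /=; rewrite /red xpair_eqE eqxx. Qed.

Lemma redVE x y : (red x y)%:R = 1 - (x == letterV y)%:R :> R.
Proof. by rewrite /red; case: eqP => _ /=; rewrite ?subrr ?subr0. Qed.

Lemma sum_word3 (F : V -> V -> V -> R) :
  \sum_(w : W) F (let0 w) (let1 w) (let2 w) =
  \sum_x \sum_y \sum_z (red x y)%:R * (red y z)%:R * (red z x)%:R * F x y z.
Proof.
transitivity (\sum_(t : 3.-tuple V | cyclically_reduced t)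
    F (tnth t (inord 0)) (tnth t (inord 1)) (tnth t (inord 2))).
  rewrite [RHS](reindex_omap (val : W -> _) insub) /=.
    by apply: eq_bigl => w; rewrite valK eqxx (valP w).
  by move=> t ht; rewrite insubT.
under [RHS]eq_bigr => x _ do rewrite pair_bigA.
rewrite pair_bigA /= big_mkcond /=.
rewrite (reindex (fun p : V * (V * V) => [tuple p.1; p.2.1; p.2.2])) /=; last first.
  exists (fun t : 3.-tuple V => (tnth t (inord 0), (tnth t (inord 1), tnth t (inord 2)))).
    move=> [x [y z]] _ /=.
    by rewrite !(tnth_nth x) !inordK.
  move=> [[|x [|y [|z [|? ?]]]] // sz] _; apply: val_inj => /=.
  by rewrite !(tnth_nth x) !inordK.
apply: eq_bigr => -[x [y z]] _ /=.
rewrite !(tnth_nth x) !inordK//= /cyclically_reduced /= -/(red x y) -/(red y z) -/(red z x).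
by rewrite andbT; do 3!case: (red _ _); rewrite ?(mul0r, mul1r, mulr0).
Qed.

(** Rotation preserves cyclic reducedness. *)
Lemma sum_word3_rot (F : V -> V -> V -> R) :
  \sum_(w : W) F (let1 w) (let2 w) (let0 w) = \sum_(w : W) F (let0 w) (let1 w) (let2 w).
Proof.
rewrite sum_word3 (sum_word3 (fun x y z => F y z x)) exchange_big /=.
apply: eq_bigr => x _; rewrite exchange_big; apply: eq_bigr => y _.
by apply: eq_bigr => z _; rewrite [_ * (red z x)%:R]mulrC mulrA.
Qed.

Lemma sum_delta (F : V -> R) a : \sum_x (x == a)%:R * F x = F a.
Proof.
rewrite (bigD1 a)//= eqxx mul1r big1 ?addr0// => x /negbTE ->.
by rewrite mul0r.
Qed.

(** The third letter avoids the inverses of [x] and [y], which coincide exactly when [x = y]. *)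
Lemma sum_third_letter x y :
  \sum_z (red y z)%:R * (red z x)%:R = N - 2 + (x == y)%:R :> R.
Proof.
transitivity (\sum_z (1 - (z == letterV y)%:R * 1 - (z == letterV x)%:R * 1
   + (z == letterV y)%:R * (z == letterV x)%:R : R)).
  by apply: eq_bigr => z _; rewrite redC !redVE; ring.
rewrite big_split !sumrB !sum_delta sumr_const /= (inj_eq (inv_inj (@letterVK _))).
rewrite [y == x]eq_sym; ring.
Qed.

Lemma sum_word_pair (F : V -> V -> R) :
  \sum_(w : W) F (let0 w) (let1 w) =
  \sum_x \sum_y (red x y)%:R * (N - 2 + (x == y)%:R) * F x y.
Proof.
rewrite (sum_word3 (fun x y _ => F x y)).
apply: eq_bigr => x _; apply: eq_bigr => y _.
rewrite -sum_third_letter mulr_sumr mulr_suml.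
by apply: eq_bigr => z _; rewrite !mulrA.
Qed.

(** The number of reduced triples with a given first letter: [N - 1] second letters, each with
    [N - 2] third letters, and one more when the second letter repeats the first. *)
Definition words_per_letter : R := (N - 1) * (N - 2) + 1.

Lemma sum_red (a : V) : \sum_y (red a y)%:R = N - 1 :> R.
Proof.
under eq_bigr => y _ do rewrite redC redVE -[(_ == _)%:R]mulr1.
by rewrite sumrB sum_delta sumr_const.
Qed.

Lemma sum_let0 (a : V) : \sum_(w : W) (let0 w == a)%:R = words_per_letter.
Proof.
rewrite (sum_word_pair (fun x _ => (x == a)%:R)).
under eq_bigr => x _ do under eq_bigr => y _ do rewrite mulrC.
under eq_bigr => x _ do rewrite -mulr_sumr.
rewrite (sum_delta (fun x => \sum_y (red x y)%:R * (N - 2 + (x == y)%:R))).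
transitivity (\sum_y ((red a y)%:R * (N - 2) + (y == a)%:R * (red a y)%:R)).
  by apply: eq_bigr => y _; rewrite eq_sym; ring.
by rewrite big_split /= -mulr_suml sum_red sum_delta red_id.
Qed.

Lemma sum_let1 (a : V) : \sum_(w : W) (let1 w == a)%:R = words_per_letter.
Proof. by rewrite (sum_word3_rot (fun x _ _ => (x == a)%:R)) sum_let0. Qed.

Lemma sum_let2 (a : V) : \sum_(w : W) (let2 w == a)%:R = words_per_letter.
Proof. by rewrite (sum_word3_rot (fun _ x _ => (x == a)%:R)) sum_let1. Qed.

Lemma card_word3 : #|W|%:R = N * words_per_letter.
Proof.
transitivity (\sum_(w : W) \sum_a ((a == let0 w)%:R * 1 : R)).
  under eq_bigr => w _ do rewrite sum_delta.
  by rewrite sumr_const.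
rewrite exchange_big /=.
under eq_bigr => a _ do under eq_bigr => w _ do rewrite mulr1 eq_sym.
under eq_bigr => a _ do rewrite sum_let0.
by rewrite sumr_const mulr_natl.
Qed.

Lemma card_letter : #|{: V}| = (2 * m)%N.
Proof. by rewrite card_prod card_ord card_bool mulnC. Qed.

Lemma letters_ge4 : 4 <= N.
Proof. by rewrite card_letter (ler_nat R 4) -[4%N]/(2 * 2)%N leq_mul2l. Qed.

Lemma words_per_letter_gt0 : 0 < words_per_letter.
Proof. by have := letters_ge4; rewrite /words_per_letter; nra. Qed.

Lemma card_word3_gt0 : (0 < #|W|)%N.
Proof.
rewrite -(ltr0n R) card_word3 mulr_gt0 ?words_per_letter_gt0//.
by have := letters_ge4; lra.
Qed.

Local Notation rk := (@enum_rank {: V}).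

(* The edges that the relation [xyz = 1] contributes to the link of the
   presentation: [x y = z^-1] puts [y] and [x^-1] at distance [z]. *)
Definition adj_edge (x y : V) : 'M[R]_#|{: V}| :=
  delta_mx (rk y) (rk (letterV x)) + delta_mx (rk (letterV x)) (rk y).

Definition adj (w : W) : 'M[R]_#|{: V}| :=
  adj_edge (let0 w) (let1 w) + adj_edge (let1 w) (let2 w)
  + adj_edge (let2 w) (let0 w).

Definition mean_adj : 'M[R]_#|{: V}| := #|W|%:R^-1 *: \sum_w adj w.

Lemma adj_sym w : (adj w)^T = adj w.
Proof.
have sym x y : (adj_edge x y)^T = adj_edge x y.
  by rewrite /adj_edge linearD /= !trmx_delta addrC.
by rewrite /adj [LHS]raddfD [X in X + _]raddfD /= !sym.
Qed.

Lemma adj_ge0 w i j : 0 <= adj w i j.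
Proof. by rewrite /adj /adj_edge !mxE !addr_ge0. Qed.

Lemma mean_adj_sym : mean_adj^T = mean_adj.
Proof.
rewrite /mean_adj linearZ /= (linear_sum trmx) /=; congr (_ *: _).
by apply: eq_bigr => w _; exact: adj_sym.
Qed.

Lemma mean_adj_ge0 i j : 0 <= mean_adj i j.
Proof.
rewrite mxE summxE mulr_ge0 ?invr_ge0// sumr_ge0// => w _; exact: adj_ge0.
Qed.

Lemma row_adj w i (a := enum_val i) :
  \sum_j adj w i j =
  (let0 w == a)%:R + (let1 w == a)%:R + (let2 w == a)%:R
  + ((let0 w == letterV a)%:R + (let1 w == letterV a)%:R + (let2 w == letterV a)%:R).
Proof.
have rowD (A B : 'M[R]_#|{: V}|) :
    \sum_j (A + B) i j = \sum_j A i j + \sum_j B i j.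
  by under eq_bigr => j _ do rewrite mxE; rewrite big_split.
have row_delta (b c : V) : \sum_j delta_mx (rk b) (rk c) i j = (b == a)%:R :> R.
  rewrite (bigD1 (rk c))//= mxE eqxx andbT -[i in i == _]enum_valK.
  rewrite (inj_eq enum_rank_inj) eq_sym big1 ?addr0// => j /negbTE jc.
  by rewrite mxE jc andbF.
rewrite /adj /adj_edge !rowD !row_delta !(inv_eq (@letterVK _)); ring.
Qed.

Lemma row_adj_le w i : \sum_j adj w i j <= 6.
Proof.
have le1 (b : bool) : b%:R <= 1 :> R by case: b.
rewrite row_adj; have := (le1 (let0 w == enum_val i), le1 (let1 w == enum_val i),
  le1 (let2 w == enum_val i), le1 (let0 w == letterV (enum_val i)),
  le1 (let1 w == letterV (enum_val i)), le1 (let2 w == letterV (enum_val i))).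
by case=> -[[[[h1 h2] h3] h4] h5] h6; lra.
Qed.

Lemma sum_row_adj i : \sum_w \sum_j adj w i j = 6 * words_per_letter.
Proof.
under eq_bigr => w _ do rewrite row_adj.
rewrite !big_split /= !(sum_let0, sum_let1, sum_let2); ring.
Qed.

Lemma row_mean_adj i : \sum_j mean_adj i j = 6 / N.
Proof.
under eq_bigr => j _ do rewrite mxE summxE.
rewrite -mulr_sumr exchange_big sum_row_adj card_word3.
have := words_per_letter_gt0; have := letters_ge4 => h1 h2.
by field; apply/andP; split; rewrite gt_eqF//; lra.
Qed.

Definition noise (w : W) : 'M[R]_#|{: V}| := adj w - mean_adj.

Lemma noise_sym w : (noise w)^T = noise w.
Proof. by rewrite /noise linearB /= adj_sym mean_adj_sym. Qed.

(** * Concentration for independent uniform relators *)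

Section RandomRelators.
Variable n : nat.
Hypothesis n_ge : (2 * m <= n)%N.
Local Notation Omega := (n.-tuple W).
Local Notation z := (n%:R / N).

Definition moment_cst (K : nat) : R := 12 ^+ (2 * K) * K.+1%:R ^+ (2 * K).+1.

Lemma density_ge1 : 1 <= z.
Proof.
have := letters_ge4 => N4; rewrite ler_pdivlMr; last by lra.
by rewrite mul1r card_letter ler_nat.
Qed.

(** The moment bound with majorant [adj w + mean_adj]: its row sums are at most [6 + 6 / N <= 12]
    and average [12 / N], whence [C = 12] and [x = N^-1]. *)
Lemma noise_moment (K : nat) :
  \sum_(r : Omega) \tr ((\sum_i noise (tnth r i)) ^+ (2 * K)) <=
  #|{: Omega}|%:R * (N * (moment_cst K * z ^+ K)).
Proof.
have N4 := letters_ge4; have k0 := words_per_letter_gt0.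
have invN : 0 <= N^-1 by rewrite invr_ge0; lra.
pose M w : 'M[R]_#|{: V}| := adj w + mean_adj.
have rowM w i : \sum_j M w i j = \sum_j adj w i j + 6 / N.
  by under eq_bigr => j _ do rewrite mxE; rewrite big_split /= row_mean_adj.
rewrite exchange_big /=.
have -> : #|{: Omega}|%:R * (N * (moment_cst K * z ^+ K)) =
    \sum_(i < #|{: V}|) #|{: Omega}|%:R * (12 ^+ (2 * K) *
      (K.+1%:R ^+ (2 * K).+1 * z ^+ K)).
  by rewrite sumr_cst card_ord /moment_cst; ring.
apply: ler_sum => i _.
apply: (@moment_bound _ _ _ _ noise M 12 N^-1 card_word3_gt0) => //.
- rewrite /noise sumrB sumr_const /mean_adj -scaler_nat scalerA mulfV ?scale1r ?subrr//.
  by rewrite pnatr_eq0 -lt0n card_word3_gt0.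
- move=> w a b; rewrite [M w a b]mxE.
  have -> : noise w a b = adj w a b - mean_adj a b.
    by rewrite [LHS]mxE; congr (_ + _); rewrite mxE.
  apply: le_trans (ler_normB _ _) _.
  by rewrite (ger0_norm (adj_ge0 w a b)) (ger0_norm (mean_adj_ge0 a b)).
- move=> w a; rewrite rowM; have := row_adj_le w a.
  have : N^-1 <= 1 by rewrite invf_le1; lra.
  lra.
- move=> a; under eq_bigr => w _ do rewrite rowM.
  rewrite big_split /= sum_row_adj sumr_cst card_word3.
  by rewrite le_eqVlt; apply/orP; left; apply/eqP; field; rewrite gt_eqF//; lra.
- exact: density_ge1.
Qed.

(** Scalars are treated as 1 by 1 matrices, so the same moment bound applies; [12] is generous here
    and lets both estimates share [moment_cst]. *)
Lemma letter_moment (K : nat) (a : V) :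
  \sum_(r : Omega) (\sum_i ((let0 (tnth r i) == a)%:R - N^-1)) ^+ (2 * K) <=
  #|{: Omega}|%:R * (moment_cst K * z ^+ K).
Proof.
have N4 := letters_ge4; have k0 := words_per_letter_gt0.
have invN : 0 <= N^-1 by rewrite invr_ge0; lra.
have invN1 : N^-1 <= 1 by rewrite invf_le1; lra.
pose y w : R := (let0 w == a)%:R - N^-1.
pose Y w : 'M[R]_1 := (y w)%:M.
pose M w : 'M[R]_1 := ((let0 w == a)%:R + N^-1)%:M.
have -> : \sum_(r : Omega) (\sum_i y (tnth r i)) ^+ (2 * K) =
    \sum_(r : Omega) ((\sum_i Y (tnth r i)) ^+ (2 * K)) 0 0.
  apply: eq_bigr => r _.
  by rewrite /Y -(raddf_sum (@scalar_mx R 1)) -(rmorphXn (@scalar_mx R 1)) mxE eqxx mulr1n.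
rewrite /moment_cst -mulrA.
have row1 (A : 'M[R]_1) i : \sum_j A i j = A 0 0.
  by rewrite big_ord1 !ord1.
apply: (@moment_bound _ _ _ _ Y M 12 N^-1 card_word3_gt0) => //.
- rewrite /Y -(raddf_sum (@scalar_mx R 1)) /y sumrB sum_let0 sumr_cst.
  rewrite card_word3; have -> : N * words_per_letter * N^-1 = words_per_letter.
    by field; rewrite gt_eqF//; lra.
  by rewrite subrr raddf0.
- move=> w i j; rewrite !mxE !ord1 eqxx !mulr1n /y.
  by apply: le_trans (ler_normB _ _) _; rewrite !ger0_norm.
- move=> w i; rewrite row1 mxE eqxx mulr1n.
  have : (let0 w == a)%:R <= 1 :> R by case: (_ == _).
  lra.
- move=> i; under eq_bigr => w _ do rewrite row1 mxE eqxx mulr1n.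
  rewrite big_split /= sum_let0 sumr_cst card_word3.
  have -> : N * words_per_letter * N^-1 = words_per_letter.
    by field; rewrite gt_eqF//; lra.
  have -> : N * words_per_letter * (12 * N^-1) = 12 * words_per_letter.
    by field; rewrite gt_eqF//; lra.
  lra.
- exact: density_ge1.
Qed.

Lemma markov_card (T : finType) (F : T -> R) (t : R) :
  (forall r, 0 <= F r) -> 0 < t -> #|[set r | t < F r]|%:R <= (\sum_r F r) / t.
Proof.
move=> F_ge0 t_gt0; rewrite ler_pdivlMr// mulr_natl -sumr_const.
rewrite [leRHS](bigID (fun r => r \in [set r | t < F r])) /=.
rewrite -[leLHS]addr0 lerD ?sumr_ge0//.
by apply: ler_sum => r; rewrite inE => /ltW.
Qed.

(** The expected first-letter count is [z]. Keeping half of it as a degree bound, a noise of norm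
    [z / 4] absorbs only half of that degree. *)
Definition typical (K : nat) (r : Omega) : bool :=
  (\tr ((\sum_i noise (tnth r i)) ^+ (2 * K)) <= (z / 4) ^+ (2 * K)) &&
  [forall a, z / 2 <= \sum_i (let0 (tnth r i) == a)%:R].

(** Markov's inequality for the trace and for each of the [N] letter counts, then a union bound; the
    trace and the letters together each cost a factor [N], hence the [2]. *)
Lemma card_atypical (K : nat) : (0 < K)%N ->
  #|[set r | ~~ typical K r]|%:R <=
  #|{: Omega}|%:R * (2 * 16 ^+ K * moment_cst K * N / z ^+ K).
Proof.
move=> K_gt0; have N4 := letters_ge4; have z1 := density_ge1.
have z0 : 0 < z by lra.
pose Om : R := #|{: Omega}|%:R.
pose dev (a : V) (r : Omega) := \sum_i ((let0 (tnth r i) == a)%:R - N^-1).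
pose B0 : {set Omega} :=
  [set r | (z / 4) ^+ (2 * K) < \tr ((\sum_i noise (tnth r i)) ^+ (2 * K))].
pose B (a : V) : {set Omega} := [set r | (z / 4) ^+ (2 * K) < dev a r ^+ (2 * K)].
have zE : (z / 4) ^+ (2 * K) = z ^+ K * z ^+ K / 16 ^+ K.
  rewrite exprM; have -> : (z / 4) ^+ 2 = z * z / 16 by field; lra.
  by rewrite expr_div_n exprMn.
have p0 : 0 < (z / 4) ^+ (2 * K) by rewrite exprn_gt0// divr_gt0.
have zK0 : z ^+ K != 0 by rewrite expf_neq0// gt_eqF.
have card0 : #|B0|%:R <= Om * (16 ^+ K * moment_cst K * N / z ^+ K).
  apply: le_trans (markov_card _ p0) _ => [r|].
    apply: mxtrace_exp_even_ge0; rewrite (linear_sum trmx) /=.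
    by apply: eq_bigr => i _; exact: noise_sym.
  rewrite ler_pdivrMr//; apply: le_trans (noise_moment K) _.
  rewrite zE le_eqVlt; apply/orP; left; apply/eqP; rewrite /Om.
  move: (z ^+ K) zK0 => w w0; field; rewrite w0 expf_neq0//.
have carda a : #|B a|%:R <= Om * (16 ^+ K * moment_cst K / z ^+ K).
  apply: le_trans (markov_card _ p0) _ => [r|].
    by rewrite exprM exprn_ge0 ?sqr_ge0.
  rewrite ler_pdivrMr//; apply: le_trans (letter_moment K a) _.
  rewrite zE le_eqVlt; apply/orP; left; apply/eqP; rewrite /Om.
  move: (z ^+ K) zK0 => w w0; field; rewrite w0 expf_neq0//.
have cardE (S : {set Omega}) : #|S|%:R = \sum_r (r \in S)%:R :> R.
  by rewrite -sum1_card natr_sum big_mkcond; apply: eq_bigr => r _; case: (r \in S).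
have cover r : (r \in [set r | ~~ typical K r])%:R <=
    (r \in B0)%:R + \sum_a (r \in B a)%:R :> R.
  have sB_ge0 : 0 <= \sum_a (r \in B a)%:R :> R by apply: sumr_ge0.
  rewrite !inE /typical negb_and -ltNge.
  have [_|_] := boolP (_ < _); first by rewrite lerDl.
  rewrite add0r /=; case: (boolP [forall a, _]) => [//|].
  rewrite negb_forall => /existsP[a]; rewrite -ltNge => small.
  suff ra : r \in B a by rewrite (bigD1 a)//= ra lerDl sumr_ge0.
  rewrite inE.
  have devE : dev a r = \sum_i (let0 (tnth r i) == a)%:R - z.
    by rewrite /dev sumrB sumr_cst card_ord.
  (* A count below [z / 2] deviates from [z] by more than [z / 4] downwards; the even power absorbs
     the sign. *)
  rewrite [X in _ < X]exprM -sqrrN -exprM ltr_pXn2r ?muln_gt0// ?nnegrE; lra.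
rewrite cardE; apply: le_trans (ler_sum _ (fun r _ => cover r)) _.
rewrite big_split /= exchange_big -cardE /=.
under eq_bigr => a _ do rewrite -cardE.
apply: le_trans (lerD card0 (ler_sum _ (fun a _ => carda a))) _.
rewrite sumr_cst -/Om le_eqVlt; apply/orP; left; apply/eqP.
by move: (z ^+ K) zK0 => w w0; field.
Qed.
End RandomRelators.
End ReducedTriples.

(** * Typical relators give property (T) *)

Section Generators.
Local Open Scope quotient_scope.
Variables (S : choiceType) (Rel : seq (word S)).
Local Notation G := (presented Rel).

Definition gen (a : letter S) : G := \pi_G [:: a].

Lemma pi_cat (u v : word S) : (\pi_G u * \pi_G v)%g = \pi_G (u ++ v).
Proof. exact: pres_mul_pi. Qed.

Lemma gen_letterV a : (gen (letterV a) * gen a)%g = 1%g.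
Proof.
rewrite pi_cat; apply/eqP/presentedP.
by have := pres_cancel Rel [::] [::] (letterV a); rewrite letterVK.
Qed.

Lemma gen_mul_letterV a : (gen a * gen (letterV a))%g = 1%g.
Proof. by rewrite -{1}[a]letterVK gen_letterV. Qed.

Lemma gen_ind (P : G -> Prop) : P 1%g ->
  (forall a g, P g -> P (gen a * g)%g) -> forall g, P g.
Proof.
move=> P1 PM g; rewrite -[g]reprK; elim: (repr g) => [|a w IH]; first exact: P1.
by rewrite -cat1s -pi_cat; exact: PM.
Qed.

Lemma relator3 x y z : [:: x; y; z] \in Rel -> (gen x * gen y * gen z)%g = 1%g.
Proof.
move=> xyz; rewrite (pi_cat [:: x] [:: y]) (pi_cat [:: x; y] [:: z]); apply/eqP/presentedP.
exact: (pres_relator [::] [::] xyz).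
Qed.

End Generators.

Section QuadraticForm.
Local Open Scope complex_scope.
Variables (R : realType) (H : lmodType R[i]) (ip : H -> H -> R).

Definition mx_form (n : nat) (f : 'I_n -> H) (M : 'M[R]_n) : R :=
  \sum_a \sum_b M a b * ip (f a) (f b).

Variables (n : nat) (f : 'I_n -> H).

Lemma mx_formD A B : mx_form f (A + B) = mx_form f A + mx_form f B.
Proof.
rewrite /mx_form -big_split; apply: eq_bigr => a _; rewrite -big_split.
by apply: eq_bigr => b _; rewrite mxE mulrDl.
Qed.

Lemma mx_formZ c A : mx_form f (c *: A) = c * mx_form f A.
Proof.
rewrite /mx_form mulr_sumr; apply: eq_bigr => a _; rewrite mulr_sumr.
by apply: eq_bigr => b _; rewrite mxE mulrA.
Qed.

Lemma mx_form_sum (I : finType) (F : I -> 'M[R]_n) :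
  mx_form f (\sum_i F i) = \sum_i mx_form f (F i).
Proof.
apply: (big_morph (mx_form f)) => [A B|]; first exact: mx_formD.
by rewrite -(scale0r 0) mx_formZ mul0r.
Qed.

Lemma mx_form_delta i j : mx_form f (delta_mx i j) = ip (f i) (f j).
Proof.
rewrite /mx_form (bigD1 i)//= (bigD1 j)//= mxE !eqxx mul1r !big1 ?addr0//.
- by move=> a /negbTE ai; rewrite big1// => b _; rewrite mxE ai mul0r.
- by move=> b /negbTE bj; rewrite mxE bj andbF mul0r.
Qed.

End QuadraticForm.

(** * The Kazhdan-type inequality for typical relators *)

Section Deterministic.
Local Open Scope complex_scope.
Variables (R : realType) (m n : nat).
Hypothesis m_gt1 : (1 < m)%N.
Local Notation V := (letter 'I_m).
Local Notation W := (cyc_reduced_word m 3).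
Local Notation N := (#|{: V}|%:R : R).
Variable r : n.-tuple W.
Local Notation Rel := [seq tval (val w) : word 'I_m | w <- tval r].
Local Notation G := (presented Rel).

Section Rep.
Variables (H : completeNormedModType R[i]) (dot : {dot H for Num.conj})
  (rho : G -> {linear H -> H}).
Hypotheses (dotN : induces_norm dot) (rhoU : unitary_rep dot rho).
Variable v : H.

Let ip := re_dot dot.
Let ipDl u1 u2 w : ip (u1 + u2) w = ip u1 w + ip u2 w. Proof. exact: re_dotDl. Qed.
Let ipZl (c : R) u w : ip (c%:C *: u) w = c * ip u w. Proof. exact: re_dotZl. Qed.
Let ipC u w : ip u w = ip w u. Proof. exact: re_dotC. Qed.
Let ip_ge0 u : 0 <= ip u u. Proof. exact: re_dot_ge0. Qed.

Let iso g u w : ip (rho g u) (rho g w) = ip u w.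
Proof. by case: rhoU => _ _ h; rewrite /ip /re_dot h. Qed.

Definition coboundary (a : V) : H := rho (gen Rel a) v - v.
Local Notation b := coboundary.
Local Notation sq u := (ip u u).

Lemma sq_coboundaryV x : sq (b (letterV x)) = sq (b x).
Proof.
have [r1 rM _] := rhoU.
rewrite -(iso (gen Rel x)) /b linearB /= -!rM gen_mul_letterV r1.
by rewrite -[v - _]opprB (ipNl ipDl) (ipNr ipDl ipC) opprK.
Qed.

(** The isometry [rho (z x)] sends [b y - b x^-1] to [v - rho z v], of norm [|b z|]; polarisation
    gives the inner product. *)
Lemma coboundary_edge x y z : (gen Rel z * gen Rel x * gen Rel y)%g = 1%g ->
  2 * ip (b y) (b (letterV x)) = sq (b y) + sq (b x) - sq (b z).
Proof.
move=> zxy; have [r1 rM _] := rhoU.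
have -> : sq (b z) = sq (b y - b (letterV x)).
  rewrite -[RHS](iso (gen Rel z * gen Rel x)%g).
  have e1 : rho (gen Rel z * gen Rel x)%g (rho (gen Rel y) v) = v.
    by rewrite -rM zxy r1.
  have e2 : rho (gen Rel z * gen Rel x)%g (rho (gen Rel (letterV x)) v) =
      rho (gen Rel z) v.
    by rewrite -rM -mulgA gen_mul_letterV mulg1.
  rewrite /b opprB addrA subrK linearB /= e1 e2.
  by rewrite -[v - _]opprB (ipNl ipDl) (ipNr ipDl ipC) opprK.
by rewrite (ip_sqrB ipDl ipC (b y) (b (letterV x))) sq_coboundaryV; ring.
Qed.

Let f (i : 'I_#|{: V}|) : H := b (enum_val i).

Lemma form_adj_edge x y :
  mx_form ip f (adj_edge R x y) = 2 * ip (b y) (b (letterV x)).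
Proof.
by rewrite mx_formD !mx_form_delta /f !enum_rankK [ip (b (letterV x)) _]ipC; ring.
Qed.

Lemma form_adj_edges w : mx_form ip f (adj R w) =
  2 * ip (b (let1 w)) (b (letterV (let0 w)))
  + 2 * ip (b (let2 w)) (b (letterV (let1 w)))
  + 2 * ip (b (let0 w)) (b (letterV (let2 w))).
Proof. by rewrite /adj mx_formD [X in X + _]mx_formD !form_adj_edge. Qed.

(** The relation holds in all three rotations; in the sum of the three edge identities each square
    occurs twice with sign plus and once with minus. *)
Lemma form_adj w : w \in tval r ->
  mx_form ip f (adj R w) = sq (b (let0 w)) + sq (b (let1 w)) + sq (b (let2 w)).
Proof.
move=> wr; have rel : [:: let0 w; let1 w; let2 w] \in Rel.
  by rewrite -word3E; apply: map_f.
have xyz := relator3 rel.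
have yzx : (gen Rel (let1 w) * gen Rel (let2 w) * gen Rel (let0 w))%g = 1%g.
  by apply: (@mulgI _ (gen Rel (let0 w))); rewrite !mulgA xyz mul1g mulg1.
have zxy : (gen Rel (let2 w) * gen Rel (let0 w) * gen Rel (let1 w))%g = 1%g.
  by apply: (@mulgI _ (gen Rel (let1 w))); rewrite !mulgA yzx mul1g mulg1.
rewrite form_adj_edges (coboundary_edge zxy) (coboundary_edge xyz).
by rewrite (coboundary_edge yzx); ring.
Qed.

Let total := \sum_a sq (b a).

Lemma sum_form_f (F : H -> R) : \sum_i F (f i) = \sum_a F (b a).
Proof.
rewrite [RHS](reindex_onto enum_val enum_rank) /= => [|a _].
  by apply: eq_bigl => i; rewrite enum_valK eqxx.
by rewrite enum_rankK.
Qed.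

Lemma form_mean_adj :
  mx_form ip f (mean_adj R m) <=
  6 * (N - 2) / #|W|%:R * sq (\sum_a b a).
Proof.
have N4 := letters_ge4 R m_gt1.
pose F (x y : V) := ip (b y) (b (letterV x)).
rewrite mx_formZ mx_form_sum.
have -> : \sum_w mx_form ip f (adj R w) =
    6 * \sum_(w : W) F (let0 w) (let1 w).
  under eq_bigr => w _ do rewrite form_adj_edges.
  rewrite !big_split /= -!mulr_sumr.
  rewrite (sum_word3_rot (fun x y _ => F x y)).
  rewrite -/(F _ _).
  rewrite -(sum_word3_rot (fun x _ z => F z x)) /=.
  by rewrite /F; ring.
have -> : 6 * (N - 2) / #|W|%:R * sq (\sum_a b a) =
    #|W|%:R^-1 * (6 * ((N - 2) * sq (\sum_a b a))) by ring.
rewrite ler_wpM2l ?invr_ge0// ler_wpM2l// sum_word_pair.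
rewrite (reindex_inj (inv_inj (@letterVK _))) /=.
rewrite [X in _ <= _ * X](ip_sumr ipDl ipC) mulr_sumr.
apply: ler_sum => x _.
(* Compared with the constant weight [N - 2], reducedness removes [y = x], and [y = x^-1] is counted
   once more. The correction is nonpositive since [<b x^-1, b x> <= |b x|^2] and [N - 2 >= 1]. *)
have -> : \sum_y (red (letterV x) y)%:R * (N - 2 + (letterV x == y)%:R) *
      F (letterV x) y =
    (N - 2) * ip (\sum_y b y) (b x) + ip (b (letterV x)) (b x)
    - (N - 2 + (letterV x == x)%:R) * sq (b x).
  rewrite (ip_suml ipDl) mulr_sumr -(sum_delta (fun y => ip (b y) (b x)) (letterV x)).
  rewrite -(sum_delta (fun y => (N - 2 + (letterV x == y)%:R) * ip (b y) (b x)) x).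
  rewrite -big_split -sumrB; apply: eq_bigr => y _ /=.
  rewrite /F letterVK redVE (inj_eq (inv_inj (@letterVK _))).
  by rewrite [x == y]eq_sym [letterV x == y]eq_sym; ring.
have := ip_ge0 (b (letterV x) - b x).
rewrite (ip_sqrB ipDl ipC (b (letterV x)) (b x)) sq_coboundaryV => ge0.
have s0 := ip_ge0 (b x).
have d0 : 0 <= (letterV x == x)%:R * sq (b x) by rewrite mulr_ge0.
rewrite mulrDl; nra.
Qed.

Lemma kazhdan_ineq_rep (j : nat) (h : R) : 0 < h ->
  \tr ((\sum_i noise R (tnth r i)) ^+ (2 ^ j.+1)) <= (h / 2) ^+ (2 ^ j.+1) ->
  (forall a, h <= \sum_i (let0 (tnth r i) == a)%:R) ->
  total <= 2 / h * (n%:R * (6 * (N - 2) / #|W|%:R)) * sq (\sum_a b a).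
Proof.
move=> h_gt0 trB deg.
have lower : h * total <= mx_form ip f (\sum_i adj R (tnth r i)).
  apply: (@le_trans _ _ (\sum_i sq (b (let0 (tnth r i))))).
    have -> : \sum_i sq (b (let0 (tnth r i))) =
        \sum_a (\sum_i (let0 (tnth r i) == a)%:R) * sq (b a).
      under [RHS]eq_bigr => a _ do rewrite mulr_suml.
      rewrite exchange_big; apply: eq_bigr => i _ /=.
      rewrite -(sum_delta (fun a => sq (b a))).
      by apply: eq_bigr => a _; rewrite eq_sym.
    by rewrite mulr_sumr ler_sum// => a _; rewrite ler_wpM2r.
  rewrite mx_form_sum ler_sum// => i _.
  (* The squares at the second and third letters are nonnegative and are dropped. *)
  rewrite form_adj ?mem_tnth// -addrA lerDl addr_ge0//.
have split_adj : \sum_i adj R (tnth r i) =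
    \sum_i noise R (tnth r i) + n%:R *: mean_adj R m.
  by rewrite /noise sumrB sumr_const card_ord scaler_nat subrK.
have noise_form : mx_form ip f (\sum_i noise R (tnth r i)) <= h / 2 * total.
  have -> : total = \sum_i sq (f i) by rewrite (sum_form_f (fun u => sq u)).
  apply: (ip_mulmx_le_trace ipDl ipZl ipC ip_ge0 f _ _ trB).
    by rewrite (linear_sum trmx); apply: eq_bigr => i _; exact: noise_sym.
  by rewrite divr_gt0.
have mean_form := ler_wpM2l (ler0n R n) form_mean_adj.
rewrite split_adj mx_formD mx_formZ in lower.
rewrite -mulrA mulrAC ler_pdivlMr// mulrC.
have : h * total <= h / 2 * total +
   n%:R * (6 * (N - 2) / #|W|%:R * sq (\sum_a b a)) by lra.
rewrite !mulrA; lra.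
Qed.

End Rep.

Lemma property_T_of_typical (j : nat) : (0 < n)%N -> typical R (2 ^ j) r ->
  property_T R G.
Proof.
move=> n_gt0 /andP[trB /forallP deg].
have N4 := letters_ge4 R m_gt1.
have N_gt0 : 0 < N by lra.
have z_gt0 : 0 < n%:R / N / 2 :> R by rewrite !divr_gt0// ltr0n.
apply: (@property_T_of_kazhdan_ineq R G {: V} (gen Rel) (@letterV 'I_m)
  (2 / (n%:R / N / 2) * (n%:R * (6 * (N - 2) / #|W|%:R)))).
- exact: letterVK.
- exact: gen_letterV.
- exact: gen_ind.
- by rewrite -(ltr0n R).
- move=> H dot rho dotN rhoU v.
  apply: (kazhdan_ineq_rep dotN rhoU v (j := j)) => //.
  have -> : n%:R / N / 2 / 2 = n%:R / N / 4 by field; rewrite gt_eqF.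
  by rewrite expnS.
Qed.

End Deterministic.

(** * The density threshold *)

Section Density.
Variables (R : realType) (d : R).
Hypothesis d_gt : 1 / 3 < d.

(** With [K = 2 ^ j] this makes [z ^ K] at least of order [N^2], so that [N / z ^ K] tends to zero.
    A power of two suits the repeated squaring in the trace bound. *)
Lemma exponent_exists : exists j, 2 <= (3 * d - 1) * (2 ^ j)%:R.
Proof.
have d1 : 0 < 3 * d - 1 by move: d_gt; lra.
exists (Num.truncn (2 / (3 * d - 1))).+1.
rewrite mulrC -ler_pdivrMr//; apply/ltW.
apply: lt_trans (truncnS_gt _) _.
by rewrite ltr_nat ltn_expl.
Qed.

Lemma unif_prob_le1 (T : finType) (E : T -> Prop) : unif_prob R E <= 1.
Proof.
rewrite /unif_prob; have [T0|T0] := posnP #|T|.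
  by rewrite T0 invr0 mulr0.
by rewrite ler_pdivrMr ?ltr0n// mul1r ler_nat max_card.
Qed.

Lemma unif_prob_ge (T : finType) (E : T -> Prop) (P : pred T) (c : R) :
  (0 < #|T|)%N -> (forall x, P x -> E x) ->
  #|[set x | ~~ P x]|%:R <= #|T|%:R * c -> 1 - c <= unif_prob R E.
Proof.
move=> T_gt0 PE cP; have T0 : 0 < #|T|%:R :> R by rewrite ltr0n.
rewrite /unif_prob ler_pdivlMr// mulrBl mul1r lerBlDr.
have cardT : #|T| = (#|[set x | P x]| + #|[set x | ~~ P x]|)%N.
  rewrite -(cardsC (finset P)); congr (_ + _)%N; apply: eq_card => x.
  by rewrite !inE.
rewrite {1}cardT natrD lerD//; last by rewrite mulrC.
rewrite ler_nat subset_leq_card//; apply/fintype.subsetP => x; rewrite !inE => Px.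
by do 2!apply/asboolP; exact: PE.
Qed.

Lemma num_relators_density (m j : nat) : 2 <= (3 * d - 1) * (2 ^ j)%:R ->
  4 ^+ (2 ^ j) + 3 <= (2 * m - 1)%N%:R :> R ->
  (2 * m <= num_relators m d)%N /\
  (2 * m)%:R / ((num_relators m d)%:R / (2 * m)%:R) ^+ (2 ^ j) <=
    2 * 4 ^+ (2 ^ j) / (2 * m - 1)%N%:R :> R.
Proof.
move=> hj; set x : R := (2 * m - 1)%N%:R; set K := (2 ^ j)%N in hj * => hx.
have K_gt0 : (0 < K)%N by rewrite expn_gt0.
have p4 : 0 < 4 ^+ K :> R by rewrite exprn_gt0.
have x3 : 3 <= x by lra.
have m_gt0 : (0 < m)%N.
  by move: x3; rewrite /x; case: (m) => //; rewrite muln0 sub0n; lra.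
have NE : (2 * m)%:R = x + 1 :> R.
  by rewrite /x natrB ?muln_gt0// subrK.
rewrite NE; set y : R := x `^ (3 * d - 1).
have y_ge0 : 0 <= y by exact: powR_ge0.
have x_ge0 : 0 <= x by lra.
have yK : x ^+ 2 <= y ^+ K.
  by rewrite -(powR_mulrn 2 x_ge0) -(powR_mulrn K y_ge0) /y -powRrM ler_powR//; lra.
(* Otherwise [x ^+ 2 <= y ^+ K < 4 ^+ K < x], which is impossible for [x >= 3]. *)
have y4 : 4 <= y.
  rewrite leNgt; apply/negP => y4.
  have : y ^+ K < 4 ^+ K by rewrite ltr_pXn2r// nnegrE.
  nra.
have nE : x * y - 1 <= (num_relators m d)%:R.
  have -> : x * y = x `^ (3 * d).
    have -> : 3 * d = 1 + (3 * d - 1) by lra.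
    by rewrite powRD ?powRr1//; apply/implyP => _; rewrite gt_eqF//; lra.
  have : x `^ (3 * d) < (num_relators m d).+1%:R by exact: truncnS_gt.
  by rewrite -natr1; lra.
set n : R := _%:R in nE *.
(* The factor [4] absorbs both the loss of at most one in the floor and the passage from [x] to
   [x + 1]. *)
have zy : y / 4 <= n / (x + 1).
  rewrite ler_pdivlMr; last by lra.
  nra.
split.
  rewrite -(ler_nat R) NE -/n.
  have : 1 <= n / (x + 1) by lra.
  by rewrite ler_pdivlMr ?mul1r//; lra.
have zK : x ^+ 2 / 4 ^+ K <= (n / (x + 1)) ^+ K.
  apply: (@le_trans _ _ ((y / 4) ^+ K)).
    by rewrite expr_div_n ler_pM2r ?invr_gt0.
  by rewrite lerXn2r// nnegrE; lra.
have x2 : 0 < x ^+ 2 / 4 ^+ K by rewrite divr_gt0 ?exprn_gt0//; lra.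
rewrite ler_pdivrMr; last exact: lt_le_trans zK.
apply: (@le_trans _ _ (2 * 4 ^+ K / x * (x ^+ 2 / 4 ^+ K))); last first.
  by rewrite ler_wpM2l// divr_ge0 ?mulr_ge0//; lra.
have -> : 2 * 4 ^+ K / x * (x ^+ 2 / 4 ^+ K) = 2 * x.
  by field; rewrite !gt_eqF//; lra.
lra.
Qed.

End Density.

Local Open Scope classical_set_scope.
Local Open Scope ring_scope.

Theorem theorem1p1 (R : realType) (d : R) (hd0 : 0 < d) (hd1 : d < 1)
    (hd : 1 / 3 < d) :
  (fun m : nat => unif_prob R
     (fun r : relator_tuple m d => property_T R (triangular_group r)))
    @ \oo --> (1 : R).
Proof.
have [j hj] := exponent_exists hd.
(* The probability of atypical relators is at most [C / (2 m - 1)]. *)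
pose C : R := 2 * 16 ^+ (2 ^ j) * moment_cst R (2 ^ j) * (2 * 4 ^+ (2 ^ j)).
have cst_ge0 : 0 <= moment_cst R (2 ^ j) by rewrite mulr_ge0 ?exprn_ge0.
have C_ge0 : 0 <= C by rewrite !mulr_ge0 ?exprn_ge0.
apply/cvgrPdist_le => e e_gt0; near=> m.
(* The first two terms put [m] in the range of [num_relators_density]; the last makes the failure
   probability at most [e]. *)
have m_big : 4 ^+ (2 ^ j) + 3 + C / e <= m%:R :> R.
  by near: m; exact: nbhs_infty_ger.
have Ce : 0 <= C / e by rewrite divr_ge0// ltW.
have p4 : 0 <= 4 ^+ (2 ^ j) :> R by rewrite exprn_ge0.
have m_gt1 : (1 < m)%N by rewrite -(ltr_nat R); lra.
have mx : m%:R <= (2 * m - 1)%N%:R :> R.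
  by rewrite ler_nat mul2n -addnn -addnBA ?leq_addr// ltnW.
have [|n_ge dens] := num_relators_density (m := m) hj; first by lra.
rewrite ger0_norm ?subr_ge0 ?unif_prob_le1//.
rewrite lerBlDr addrC -lerBlDr.
apply: (@unif_prob_ge _ _ _ (@typical R m (num_relators m d) (2 ^ j))).
- by rewrite card_tuple expn_gt0 (card_word3_gt0 R m_gt1).
- move=> r; apply: property_T_of_typical => //.
  by apply: leq_trans n_ge; rewrite muln_gt0 (ltnW m_gt1).
- have K_gt0 : (0 < 2 ^ j)%N by rewrite expn_gt0.
  apply: (le_trans (card_atypical R m_gt1 n_ge K_gt0)).
  rewrite ler_wpM2l// card_letter -mulrA.
  apply: le_trans (ler_wpM2l _ dens) _; first by rewrite !mulr_ge0 ?exprn_ge0.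
  have m0 : 0 < (2 * m - 1)%N%:R :> R by lra.
  rewrite mulrA ler_pdivrMr// -ler_pdivrMl// mulrC -/C.
  by apply: le_trans mx; lra.
Unshelve. all: by end_near.
Qed.
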